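(* Let $T\ge1$ and let $\{\mathbb U^\natural_t\}_{0\le t\le T-1}$, $\{\mathbb U^\flat_t\}_{1\le t\le T}$, $\{\mathbb W_t\}_{1\le t\le T}$, $\{\mathbb X_t\}_{0\le t\le T}$ be Borel spaces. For $0\le t\le T-1$ let $f_t:\mathbb X_t\times\mathbb U^\natural_t\times\mathbb W_{t+1}\times\mathbb U^\flat_{t+1}\to\mathbb X_{t+1}$ be Borel-measurable and let $L_t:\mathbb X_t\times\mathbb U^\natural_t\times\mathbb W_{t+1}\times\mathbb U^\flat_{t+1}\to[0,+\infty]$ be lower semianalytic; let $K:\mathbb X_T\to[0,+\infty]$ be lower semianalytic. Let $(\Omega,\mathcal F,\mathbb P)$ be a Borel probability space, $\mathbf X_0:\Omega\to\mathbb X_0$ a random variable and $\mathbf W_t:\Omega\to\mathbb W_t$, $1\le t\le T$, a stochastic process. Consider the problem $$\inf_{(\mathbf U^\natural_t,\mathbf U^\flat_{t+1})_{0\le t\le T-1}}\mathbb E\Big[\sum_{t=0}^{T-1}L_t(\mathbf X_t,\mathbf U^\natural_t,\mathbf W_{t+1},\mathbf U^\flat_{t+1})+K(\mathbf X_T)\Big]$$ over random variables $\mathbf U^\natural_t:\Omega\to\mathbb U^\natural_t$ and $\mathbf U^\flat_t:\Omega\to\mathbb U^\flat_t$ subject to $$\sigma(\mathbf U^\natural_t)\subset\sigma(\mathbf X_0,\mathbf W_1,\dots,\mathbf W_t)\ (0\le t\le T-1),\qquad \sigma(\mathbf U^\flat_t)\subset\sigma(\mathbf X_0,\mathbf W_1,\dots,\mathbf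 W_t)\ (1\le t\le T),$$ $$\mathbf X_{t+1}=f_t(\mathbf X_t,\mathbf U^\natural_t,\mathbf W_{t+1},\mathbf U^\flat_{t+1})\ (0\le t\le T-1).$$ If $\mathbf X_0$ is deterministic with value $x_0$ and if the random variables $\mathbf W_1,\dots,\mathbf W_T$ are independent, then the value of this problem equals $V_0(x_0)$, where the functions $V_t$ are given by the backward induction $$V_T(x)=K(x),\qquad V_t(x)=\inf_{u^\natural\in\mathbb U^\natural_t}\mathbb E\Big[\inf_{u^\flat\in\mathbb U^\flat_{t+1}}\Big\{L_t(x,u^\natural,\mathbf W_{t+1},u^\flat)+V_{t+1}\big(f_t(x,u^\natural,\mathbf W_{t+1},u^\flat)\big)\Big\}\Big],\quad 0\le t\le T-1 .$$
   Context: A Borel space is a Borel subset of a Polish space (up to homeomorphism) with its Borel $\sigma$-field. A function $\varphi:\mathbb X\to[0,+\infty]$ on a Borel space is lower semianalytic if $\{x:\varphi(x)<c\}$ is an analytic set for every $c\in\mathbb R$. Such functions are universally measurable, and expectations of universally measurable nonnegative functions of random variables are taken with respect to completed measures. $\sigma(\cdot)$ denotes the generated $\sigma$-field. *)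

(* Defs.v *)
From HB Require Import structures.
From mathcomp Require Import all_boot all_order all_algebra.
From mathcomp Require Import all_classical all_reals all_analysis.

Set Implicit Arguments.
Unset Strict Implicit.
Unset Printing Implicit Defensive.
Import Order.TTheory GRing.Theory Num.Theory.
Import numFieldNormedType.Exports.

Local Open Scope classical_set_scope.
Local Open Scope ring_scope.
Local Open Scope ereal_scope.

(** * Borel spaces, Borel maps, analytic sets *)

Definition borel (X : topologicalType) : set (set X) := <<s @open X >>.

Definition borel_measurable (X Y : topologicalType) (g : X -> Y) : Prop :=
  forall B, borel B -> borel (g @^-1` B).

(* A Hausdorff pseudometric space is a metric space. Library complete spaces
   are pointed, hence nonempty; this loses nothing in [borel_space], where the
   empty space is an (empty) Borel subset of any Polish space. *)
Definition polish (R : realType) (Y : completePseudoMetricType R) : Prop :=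
  hausdorff_space Y /\ exists2 D : set Y, countable D & dense D.

(* The map [i] is a homeomorphism from [X] onto the Borel subset [range i] of
   [Y], endowed with the trace topology. *)
Definition borel_space (R : realType) (X : topologicalType) : Prop :=
  exists (Y : completePseudoMetricType R) (i : X -> Y),
    [/\ polish Y, injective i, continuous i,
        forall A, open A -> exists2 B, open B & A = i @^-1` B
      & borel (range i)].

Definition baire_space : topologicalType := prod_topology (fun _ : nat => nat).

Definition analytic (X : topologicalType) (A : set X) : Prop :=
  A = set0 \/ exists2 g : baire_space -> X, continuous g & A = range g.

Definition lower_semianalytic (R : realType) (X : topologicalType)
    (phi : X -> \bar R) : Prop :=
  forall c : R, analytic [set x | phi x < c%:E].

(** * Random variables on a topological probability space *)

(* The sample space with its Borel sigma-field. *)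
Notation borelType Omega := (g_sigma_algebraType (@open Omega)).

(* The integral is taken over the Caratheodory sigma-field of the outer measure
   induced by [P], which is the [P]-completion of the Borel sigma-field. *)
Definition expect (R : realType) (Omega : ptopologicalType)
    (P : probability (borelType Omega) R) (Z : Omega -> \bar R) : \bar R :=
  \int[@completed_measure_extension _ _ _ P]_w Z w.

Definition sigma_of (Omega : Type) (Y : topologicalType) (Z : Omega -> Y) :
    set (set Omega) :=
  preimage_set_system setT Z (@borel Y).

Definition mutually_independent (R : realType) (Omega : ptopologicalType)
    (P : probability (borelType Omega) R) (I : finType)
    (Y : I -> topologicalType) (Z : forall i, Omega -> Y i) : Prop :=
  forall (J : {set I}) (A : forall i, set (Y i)),
    (forall i, borel (A i)) ->
    P (\bigcap_(i in [set` J]) Z i @^-1` A i) =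
      \prod_(i in J) P (Z i @^-1` A i).

(** * The optimization problem *)

(* Spaces, dynamics, costs and noises are indexed by all of [nat], but only
   their values within the horizon [T] are ever used; the decisions and the
   states, which are quantified over, are indexed by ordinals, so that spaces
   beyond the horizon (which may be empty) play no role. In the decision
   process [uf], the component of index [t] is the decision taken at time
   [t.+1]. *)

(* sigma(X_0, W_1, ..., W_t) *)
Definition history (Omega : Type) (X0 : topologicalType)
    (W : nat -> topologicalType) (x0 : Omega -> X0)
    (w : forall t, Omega -> W t) (t : nat) : set (set Omega) :=
  <<s sigma_of x0 `|`
      \bigcup_(s in [set s | (1 <= s <= t)%N]) sigma_of (w s) >>.

Definition admissible (T : nat) (Un Uf W X : nat -> topologicalType)
    (f : forall t, X t * Un t * W t.+1 * Uf t.+1 -> X t.+1)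
    (Omega : topologicalType) (x0 : Omega -> X 0%N)
    (w : forall t, Omega -> W t)
    (un : forall t : 'I_T, Omega -> Un t)
    (uf : forall t : 'I_T, Omega -> Uf t.+1)
    (x : forall t : 'I_T.+1, Omega -> X t) : Prop :=
  [/\ forall t : 'I_T, borel_measurable (un t) /\
        sigma_of (un t) `<=` history x0 w t,
      forall t : 'I_T, borel_measurable (uf t) /\
        sigma_of (uf t) `<=` history x0 w t.+1,
      x ord0 = x0
    & forall (t : 'I_T) (o : Omega),
        x (lift ord0 t) o =
          f t (x (widen_ord (leqnSn T) t) o, un t o, w t.+1 o, uf t o)].

Definition cost (R : realType) (T : nat) (Un Uf W X : nat -> topologicalType)
    (L : forall t, X t * Un t * W t.+1 * Uf t.+1 -> \bar R)
    (K : X T -> \bar R)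
    (Omega : ptopologicalType) (P : probability (borelType Omega) R)
    (w : forall t, Omega -> W t)
    (un : forall t : 'I_T, Omega -> Un t)
    (uf : forall t : 'I_T, Omega -> Uf t.+1)
    (x : forall t : 'I_T.+1, Omega -> X t) : \bar R :=
  expect P (fun o =>
    (\sum_(t < T)
      L t (x (widen_ord (leqnSn T) t) o, un t o, w t.+1 o, uf t o))
    + K (x ord_max o)).

Definition problem_value (R : realType) (T : nat)
    (Un Uf W X : nat -> topologicalType)
    (f : forall t, X t * Un t * W t.+1 * Uf t.+1 -> X t.+1)
    (L : forall t, X t * Un t * W t.+1 * Uf t.+1 -> \bar R)
    (K : X T -> \bar R)
    (Omega : ptopologicalType) (P : probability (borelType Omega) R)
    (x0 : Omega -> X 0%N) (w : forall t, Omega -> W t) : \bar R :=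
  ereal_inf [set c | exists un uf x,
    admissible f x0 w un uf x /\ c = cost L K P w un uf x].

(* Functions satisfying a backward recursion exist; they are determined at all
   times [t <= T], and arbitrary afterwards. *)
Lemma backward_induction_ex (E : Type) (X : nat -> Type) (T : nat)
    (K : X T -> E) (F : forall t, (X t.+1 -> E) -> X t -> E) (e : E) :
  exists V : forall t, X t -> E,
    V T = K /\ forall t, (t < T)%N -> V t = F t (V t.+1).
Proof.
elim: T K => [|T IH] K.
  exists (@eqtype.dfwith nat (fun t => X t -> E) (fun _ _ => e) 0%N K).
  by rewrite eqtype.dfwith_in.
have [V [VT VS]] := IH (F T K).
exists (@eqtype.dfwith nat (fun t => X t -> E) V T.+1 K).
rewrite eqtype.dfwith_in; split=> //.
move=> t; rewrite ltnS leq_eqVlt => /predU1P[->|tT].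
  by rewrite eqtype.dfwith_in eqtype.dfwith_out ?gtn_eqF// VT.
have Tt : T.+1 != t by rewrite gtn_eqF// ltnS ltnW.
have TSt : T.+1 != t.+1 by rewrite gtn_eqF.
rewrite (eqtype.dfwith_out _ _ Tt) (eqtype.dfwith_out _ _ TSt); exact: VS.
Qed.

(* Main.v *)
(* Analytic sets are replaced by the Souslin operation A = {x | exists y, for all
   n, x in F (y|n)} over an arbitrary sigma-algebra, y ranging over nat -> nat.
   The class is stable under countable unions and intersections, measurable
   preimages and projections along Borel spaces. By Choquet's capacitability
   argument the outer measure of A is the supremum over b of the measures of
   the sets {x | exists y <= b, for all n, x in F (y|n)}, which by Koenig's
   lemma are decreasing limits of finite unions of the F s. Hence A is measurable
   for the completed measure; sections of outer measure > r form again a Souslin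
   set, so that x |-> E[H(x, W)] has Souslin sublevel sets whenever H >= 0 does;
   and leftmost branches give almost everywhere measurable selections.

   Consequently every V_t has Souslin sublevel sets. The infimum of
   E[L_0 + ... + L_(t-1) + V_t(X_t)] over the policies up to time t does not
   depend on t: independence of the past and W_(t+1) allows one to integrate
   W_(t+1) out, which yields one inequality, and measurable e-optimal decisions
   at time t yield the other. At t = T this infimum is the value of the problem
   and at t = 0 it is V_0(x_0). *)
Require Import Defs.
From HB Require Import structures.
From mathcomp Require Import all_boot all_order all_algebra.
From mathcomp Require Import all_classical all_reals all_analysis.
From mathcomp Require Import lra measurable_realfun.
Import Order.TTheory GRing.Theory Num.Theory.
Import numFieldNormedType.Exports.
Local Open Scope classical_set_scope.
Local Open Scope ring_scope.
Local Open Scope ereal_scope.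

Set Implicit Arguments.
Unset Strict Implicit.

(** * The Souslin operation *)

(** Admissible decisions must be measurable for the history sigma-field itself, not merely for its
    completion. That sigma-field comes with no topology, so schemes live over bare classes of sets,
    and selection runs on the sigma-algebra of available information with the restriction of [P]:
    the selected map is measurable everywhere, and only its near-optimality fails on a null set,
    which expectations ignore.

    Topology enters in few places: analytic sets are Souslin over closed sets, countable bases put
    the Borel field of a product inside the product sigma-field, and a nonempty Borel space is the
    image of Baire space under a map with measurable preimages. Such a map replaces any isomorphism
    theorem.

    The value functions need not be Borel; only their strict sublevel sets are controlled. Each use
    is reduced to such sets: a sum by a rational cut, an expectation by upper Riemann sums of outer
    measures, e-optimality by a measurable function equal to the infimum off a null set. *)

Definition suslin (T : Type) (M : set (set T)) : set (set T) :=
  [set A | exists2 F : seq nat -> set T, (forall s, M (F s)) &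
    A = [set x | exists y : nat -> nat, forall n, F (mkseq y n) x]].

Definition interclosed (T : Type) (M : set (set T)) : Prop :=
  M setT /\ setI_closed M.

(* How many coordinates of [y] matter for [G y] may depend on [y]. *)
Definition finitary (E : Type) (G : (nat -> nat) -> E) : Prop :=
  forall y, exists m, forall y', mkseq y' m = mkseq y m -> G y' = G y.

Lemma mkseqP (y y' : nat -> nat) n :
  mkseq y n = mkseq y' n <-> forall i, (i < n)%N -> y i = y' i.
Proof.
split=> [e i lin|e].
  by have := congr1 (nth 0%N ^~ i) e; rewrite /= !nth_mkseq.
apply: (@eq_from_nth _ 0%N); rewrite !size_mkseq// => i lin.
by rewrite !nth_mkseq// e.
Qed.

Lemma finitary_cst E (c : E) : finitary (fun=> c).
Proof. by move=> y; exists 0%N. Qed.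

Lemma finitary_prefix (E : Type) (F : seq nat -> E) (c : nat -> nat) n :
  finitary (fun y => F (mkseq (fun i => y (c i)) n)).
Proof.
move=> y; exists (\max_(i < n) (c i).+1)%N => y' /mkseqP e; congr F.
by apply/mkseqP => i lin; apply: e; apply: (leq_bigmax (Ordinal lin)).
Qed.

Lemma finitary2 (E1 E2 E : Type) (g : E1 -> E2 -> E) G1 G2 :
  finitary G1 -> finitary G2 -> finitary (fun y => g (G1 y) (G2 y)).
Proof.
move=> f1 f2 y; have [m1 e1] := f1 y; have [m2 e2] := f2 y.
exists (maxn m1 m2) => y' /mkseqP e; rewrite e1 ?e2//; apply/mkseqP => i im.
  by apply: e; rewrite (leq_trans im)// leq_maxr.
by apply: e; rewrite (leq_trans im)// leq_maxl.
Qed.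

Section suslin_theory.
Variables (T : Type).
Implicit Types M N : set (set T).

Lemma interclosed_bigcap M (P : set nat) (F : nat -> set T) n :
  interclosed M -> (forall i, M (F i)) ->
  M (\bigcap_(i in [set i | (i < n)%N /\ P i]) F i).
Proof.
move=> [MT MI] MF; elim: n => [|n IH].
  by rewrite (_ : [set _ | _] = set0) ?bigcap_set0//; apply/seteqP; split=> // i [].
have [Pn|Pn] := pselect (P n).
  rewrite (_ : [set _ | _] = [set i | (i < n)%N /\ P i] `|` [set n]).
    by rewrite bigcap_setU bigcap_set1; apply: MI.
  apply/seteqP; split=> i /=.
    by move=> [+ Pi]; rewrite ltnS leq_eqVlt => /predU1P[->|]; [right|left].
  by case=> [[ilt Pi]|->]; split=> //; rewrite ltnW.
rewrite (_ : [set i | (i < n.+1)%N /\ P i] = [set i | (i < n)%N /\ P i])//.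
apply/seteqP; split=> i /= [ilt Pi]; split=> //; last exact: ltnW.
by move: ilt; rewrite ltnS leq_eqVlt => /predU1P[ein|//]; rewrite ein in Pi.
Qed.

(** A prefix [s] is charged only with the conditions it already decides: [F s] intersects those
    [G n], [n < size s], that are constant on the cylinder of [s]. Every [G n y] is decided by some
    long prefix of [y], so no condition is lost, and the bound on [n] keeps the intersection
    finite. *)
Lemma finitary_scheme M (G : nat -> (nat -> nat) -> set T) : interclosed M ->
  (forall n y, M (G n y)) -> (forall n, finitary (G n)) ->
  exists2 F : seq nat -> set T, (forall s, M (F s)) &
    forall x y, (forall n, F (mkseq y n) x) <-> (forall n, G n y x).
Proof.
move=> MI MG fG.
pose decided s n := forall y', mkseq y' (size s) = s -> G n y' = G n (nth 0%N s).
exists (fun s => \bigcap_(n in [set n | (n < size s)%N /\ decided s n]) G n (nth 0%N s)).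
  by move=> s; apply: interclosed_bigcap.
have mknth s k : k = size s -> mkseq (nth 0%N s) k = s.
  move=> ->; apply: (@eq_from_nth _ 0%N); rewrite size_mkseq// => i ik.
  by rewrite nth_mkseq.
move=> x y; split=> Gy n; last first.
  move=> k [_ dk]; rewrite -(dk y) ?size_mkseq//; exact: Gy.
have [m em] := fG n y.
pose k := maxn m n.+1.
have em' y' : mkseq y' k = mkseq y k -> G n y' = G n y.
  move=> /mkseqP e; apply: em; apply/mkseqP => i im; apply: e.
  by rewrite (leq_trans im)// leq_maxl.
have ek : mkseq (nth 0%N (mkseq y k)) k = mkseq y k by rewrite mknth// size_mkseq.
rewrite -(em' _ ek); apply: (Gy k); split.
  by rewrite size_mkseq leq_maxr.
by move=> y'; rewrite size_mkseq => /em' ->; rewrite (em' _ ek).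
Qed.

Lemma suslin_finitary M (G : nat -> (nat -> nat) -> set T) : interclosed M ->
  (forall n y, M (G n y)) -> (forall n, finitary (G n)) ->
  suslin M [set x | exists y, forall n, G n y x].
Proof.
move=> MI MG fG; have [F MF FG] := finitary_scheme MI MG fG.
by exists F => //; apply/seteqP; split=> x [y /FG]; exists y.
Qed.

Lemma sub_suslin M : M `<=` suslin M.
Proof.
move=> A MA; exists (fun=> A) => //; apply/seteqP; split=> x.
  by move=> Ax; exists (fun=> 0%N).
by case=> y /(_ 0%N).
Qed.

Lemma suslin_sub M N : M `<=` N -> suslin M `<=` suslin N.
Proof. by move=> MN A [F MF ->]; exists F => // s; apply: MN. Qed.

(** One branch [w] codes countably many: through the pairing [c], row 0 is the outer branch and row
    [n.+1] the inner branch witnessing membership in the [n]-th node of the outer one. Each inner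
    condition reads finitely many entries of [w]. *)
Lemma suslin_suslin M : interclosed M -> suslin (suslin M) `<=` suslin M.
Proof.
move=> MI A [D MD ->].
have {MD} /choice[F MF] : forall s, exists F : seq nat -> set T, (forall s, M (F s)) /\
    D s = [set x | exists y : nat -> nat, forall n, F (mkseq y n) x].
  by move=> s; have [F ? ?] := MD s; exists F.
pose c (k i : nat) : nat := pickle (k, i).
pose G (p : nat) (w : nat -> nat) : set T := if unpickle p is Some (n, m) then
  F (mkseq (fun i => w (c 0%N i)) n) (mkseq (fun i => w (c n.+1 i)) m) else setT.
rewrite (_ : [set _ | _] = [set x | exists w, forall p, G p w x]).
  apply: suslin_finitary => // [p w|p]; rewrite /G.
    by case: unpickle => [[n m]|]; [exact: (MF _).1|exact: MI.1].
  case: unpickle => [[n m]|]; last exact: finitary_cst.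
  by apply: (finitary2 F); exact: (finitary_prefix id).
apply/seteqP; split=> x.
  move=> [y Dy].
  have /choice[z Fz] : forall n, exists z : nat -> nat, forall m,
      F (mkseq y n) (mkseq z m) x.
    by move=> n; have := Dy n; rewrite (MF _).2.
  exists (fun j => if unpickle j is Some (k, i) then
      (if k is k'.+1 then z k' i else y i) else 0%N).
  move=> p; rewrite /G; case: unpickle => [[n m]|//]; have := Fz n m.
  congr (F _ _ x); apply/mkseqP => i _ /=; rewrite /c pickleK //.
move=> [w Gw]; exists (fun i => w (c 0%N i)) => n; rewrite (MF _).2.
exists (fun i => w (c n.+1 i)) => m.
by have := Gw (pickle (n, m)); rewrite /G pickleK.
Qed.

Lemma suslin_bigcap M (A : nat -> set T) : interclosed M ->
  (forall n, suslin M (A n)) -> suslin M (\bigcap_n A n).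
Proof.
move=> MI MA; apply: suslin_suslin => //.
exists (fun s => A (size s)) => //; apply/seteqP; split=> x.
  by move=> Ax; exists (fun=> 0%N) => n; apply: Ax.
by move=> [y Ay] n _; have := Ay n; rewrite size_mkseq.
Qed.

(** The first digit of the branch chooses the index of the union. *)
Lemma suslin_bigcup M (A : nat -> set T) : interclosed M ->
  (forall n, suslin M (A n)) -> suslin M (\bigcup_n A n).
Proof.
move=> MI MA; apply: suslin_suslin => //.
exists (fun s => if s is k :: _ then A k else setT).
  by case=> [|k s]//; apply: sub_suslin; exact: MI.1.
apply/seteqP; split=> x.
  by move=> [k _ Ax]; exists (fun=> k); case.
by move=> [y Ay]; exists (y 0%N) => //; exact: (Ay 1%N).
Qed.

Lemma suslin_interclosed M : interclosed M -> interclosed (suslin M).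
Proof.
move=> MI; split; first by apply: sub_suslin; exact: MI.1.
move=> A B MA MB; rewrite -bigcap2E; apply: suslin_bigcap => //.
by case=> [|[|n]]//=; apply: sub_suslin; exact: MI.1.
Qed.

End suslin_theory.

Lemma suslin_preimage (T U : Type) (M : set (set T)) (N : set (set U))
    (g : T -> U) A :
  (forall B, N B -> M (g @^-1` B)) -> suslin N A -> suslin M (g @^-1` A).
Proof.
move=> gN [F NF ->]; exists (fun s => g @^-1` F s) => // s; exact: gN.
Qed.

(** * Product sigma-algebras and projections *)

Definition prod_sigma (T U : Type) (M : set (set T)) (N : set (set U)) :
    set (set (T * U)) :=
  <<s [set A `*` B | A in M & B in N] >>.

Definition baire_sigma : set (set (nat -> nat)) :=
  <<s range (fun s => [set y : nat -> nat | mkseq y (size s) = s]) >>.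

Lemma salg_setC T (M : set (set T)) A :
  sigma_algebra setT M -> M A -> M (~` A).
Proof. by move=> [_ MC _] MA; rewrite -setTD; exact: MC. Qed.

Lemma salg_setT T (M : set (set T)) : sigma_algebra setT M -> M setT.
Proof. by move=> [M0 MC _]; rewrite -(setD0 setT); exact: MC. Qed.

Lemma salg_bigcap T (M : set (set T)) (F : nat -> set T) :
  sigma_algebra setT M -> (forall i, M (F i)) -> M (\bigcap_i F i).
Proof.
move=> sM MF; rewrite -[X in M X]setCK; apply: salg_setC => //.
rewrite setC_bigcap; case: (sM) => _ _; apply => i.
exact: salg_setC.
Qed.

Lemma salg_setU T (M : set (set T)) A B :
  sigma_algebra setT M -> M A -> M B -> M (A `|` B).
Proof.
move=> [M0 _ MU] MA MB; rewrite -bigcup2E; apply: MU.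
by case=> [|[|n]].
Qed.

Lemma salg_interclosed T (M : set (set T)) :
  sigma_algebra setT M -> interclosed M.
Proof.
move=> sM; split; first exact: salg_setT.
move=> A B MA MB; rewrite -[X in M X]setCK setCI.
by apply: salg_setC => //; apply: salg_setU => //;
  exact: salg_setC.
Qed.

(** A finitary predicate is locally constant, hence a union of the cylinders on which it holds;
    finite sequences being countable, the union is too. *)
Lemma finitary_baire (G : (nat -> nat) -> Prop) : finitary G ->
  baire_sigma [set y | G y].
Proof.
move=> fG; pose K (n : nat) : set (nat -> nat) :=
  if @unpickle (seq nat) n is Some s then
    [set y : nat -> nat | mkseq y (size s) = s /\
       forall y', mkseq y' (size s) = s -> G y'] else set0.
have -> : [set y | G y] = \bigcup_n K n.
  apply/seteqP; split=> y.
    move=> Gy; have [m e] := fG y; exists (pickle (mkseq y m)) => //.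
    by rewrite /K pickleK /= size_mkseq; split=> // y' /e ->.
  by move=> [n _]; rewrite /K; case: (unpickle n) => [s [ys]|[]]; apply.
have bS : sigma_algebra setT baire_sigma by exact: smallest_sigma_algebra.
case: (bS) => b0 _ bU; apply: bU => n; rewrite /K.
case: (unpickle n) => [s|//].
have [h|h] := pselect (forall y', mkseq y' (size s) = s -> G y').
  rewrite (_ : [set _ | _] = [set y : nat -> nat | mkseq y (size s) = s]).
    by apply: sub_sigma_algebra; exists s.
  by apply/seteqP; split=> y //= [].
by rewrite (_ : [set _ | _] = set0)//; apply/seteqP; split=> y //= [].
Qed.

Lemma salg_preimage_sub T U (M : set (set T)) (G : set (set U))
    (g : T -> U) :
  sigma_algebra setT M -> (forall B, G B -> M (g @^-1` B)) ->
  forall B, <<s G >> B -> M (g @^-1` B).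
Proof.
move=> sM GM; apply: smallest_sub => //; split.
- by rewrite /= preimage_set0; case: sM.
- by move=> A MA /=; rewrite setTD preimage_setC; exact: salg_setC.
- by move=> F MF /=; rewrite preimage_bigcup; case: sM => _ _; apply.
Qed.

Lemma prod_sigma_rect T U (M : set (set T)) (N : set (set U)) A B :
  M A -> N B -> prod_sigma M N (A `*` B).
Proof. by move=> MA NB; apply: sub_sigma_algebra; exists A => //; exists B. Qed.

Lemma prod_sigma_algebra T U (M : set (set T)) (N : set (set U)) :
  sigma_algebra setT (prod_sigma M N).
Proof. exact: smallest_sigma_algebra. Qed.

Lemma prod_sigma_preimage T U S (M : set (set T)) (N : set (set U))
    (O : set (set S)) (g : S -> T) (h : S -> U) :
  sigma_algebra setT O -> (forall A, M A -> O (g @^-1` A)) ->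
  (forall B, N B -> O (h @^-1` B)) ->
  forall E, prod_sigma M N E -> O ((fun s => (g s, h s)) @^-1` E).
Proof.
move=> sO Og Oh; apply: salg_preimage_sub => // _ [A MA [B NB <-]].
by apply: (salg_interclosed sO).2; [exact: Og|exact: Oh].
Qed.

Section baire_projection.
Variables (T : Type) (M : set (set T)).
Hypothesis sM : sigma_algebra setT M.

(** Measurable sections, locally constant in the Baire variable: this class is closed under
    complement and intersection, and the Souslin operation over it reaches the whole product
    sigma-algebra. *)
Let R : set (set (T * (nat -> nat))) :=
  [set E | exists2 G : (nat -> nat) -> set T, finitary G /\ (forall y, M (G y)) &
    E = [set z | G z.2 z.1]].

Let R_interclosed : interclosed R.
Proof.
split.
  exists (fun=> setT); last by apply/seteqP.
  by split; [exact: finitary_cst|move=> _; exact: salg_setT].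
move=> _ _ [G [fG MG] ->] [H [fH MH] ->].
exists (fun y => G y `&` H y) => //; split; first exact: finitary2.
by move=> y; apply: (salg_interclosed sM).2.
Qed.

(** Souslin sets are not stable under complement; requiring the complement to be Souslin as well
    yields a sigma-algebra. *)
Let C : set (set (T * (nat -> nat))) :=
  [set E | suslin R E /\ suslin R (~` E)].

Let C_sigma : sigma_algebra setT C.
Proof.
have RC E : R E -> R (~` E).
  move=> [G [fG MG] ->]; exists (fun y => ~` G y) => //; split.
    by move=> y; have [m e] := fG y; exists m => y' /e ->.
  by move=> y; exact: salg_setC.
split.
- split; last by rewrite setC0; apply: sub_suslin; exact: R_interclosed.1.
  by apply: sub_suslin; rewrite -setCT; apply: RC; exact: R_interclosed.1.
- by move=> A [RA RCA]; rewrite setTD; split; rewrite ?setCK.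
- move=> F CF; split; first by apply: suslin_bigcup => // n; exact: (CF n).1.
  by rewrite setC_bigcup; apply: suslin_bigcap => // n; exact: (CF n).2.
Qed.

Let prod_baire_sub : prod_sigma M baire_sigma `<=` suslin R.
Proof.
have CR E : R E -> R (~` E) -> C E by move=> *; split; apply: sub_suslin.
suff : prod_sigma M baire_sigma `<=` C by move=> sub E /sub[].
apply: smallest_sub => // _ [A MA [B NB <-]].
suff CB : C (snd @^-1` B).
  rewrite (_ : A `*` B = fst @^-1` A `&` snd @^-1` B); last by apply/seteqP; split=> z [].
  apply: (salg_interclosed C_sigma).2 => //; apply: CR.
    by exists (fun=> A) => //; split => //; exact: finitary_cst.
  exists (fun=> ~` A) => //; split; first exact: finitary_cst.
  by move=> _; exact: salg_setC.
move: B NB; apply: salg_preimage_sub => // _ [s _ <-].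
have fs : finitary (fun y : nat -> nat => [set x : T | mkseq y (size s) = s]).
  exact: (finitary_prefix (fun s' => [set x : T | s' = s]) id).
have Mp (p : Prop) : M [set _ | p].
  have [hp|hp] := pselect p.
    rewrite (_ : [set _ | _] = setT); last by apply/seteqP; split.
    exact: salg_setT.
  rewrite (_ : [set _ | _] = set0); last by apply/seteqP; split.
  by case: sM.
apply: CR; first by eexists; [split; [exact: fs|]|].
exists (fun y => [set x : T | mkseq y (size s) <> s]) => //; split=> //.
exact: (finitary_prefix (fun s' => [set x : T | s' <> s]) id).
Qed.

(* A scheme for the projection of [A] whose branches [w] code, through [q],
   points of the sections of [A]. *)
Lemma proj_baire_scheme (A : set (T * (nat -> nat))) :
  suslin (prod_sigma M baire_sigma) A ->
  exists F q, [/\ forall s, M (F s),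
    forall B, baire_sigma B -> baire_sigma (q @^-1` B),
    forall x w, (forall n, F (mkseq w n) x) -> A (x, q w) &
    forall x y, A (x, y) -> exists w : nat -> nat, forall n, F (mkseq w n) x].
Proof.
move=> /(suslin_sub prod_baire_sub)/(suslin_suslin R_interclosed)[F RF ->].
have /choice[G /all_and2[/all_and2[fG MG] FG]] : forall s,
    exists G : (nat -> nat) -> set T,
    (finitary G /\ (forall y, M (G y))) /\ F s = [set z | G z.2 z.1].
  by move=> s; have [G ? ?] := RF s; exists G.
(* Row 0 of a branch carries the point of Baire space, row 1 the Souslin witness that this point
   lies in the section. *)
pose c k i : nat := pickle ((k, i) : nat * nat).
have [|||K MK KG] := @finitary_scheme _ M
    (fun n w => G (mkseq (fun i => w (c 1%N i)) n) (fun i => w (c 0%N i))).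
- exact: salg_interclosed.
- by move=> n y; exact: MG.
- move=> n y; have [m1 e1] := fG (mkseq (fun i => y (c 1%N i)) n) (fun i => y (c 0%N i)).
  have [m2 e2] := finitary_prefix (fun s => s) (c 1%N) n y.
  have [m3 e3] := finitary_prefix (fun s => s) (c 0%N) m1 y.
  exists (maxn m2 m3) => y' /mkseqP e; rewrite e2; last first.
    by apply/mkseqP => i im; apply: e; rewrite (leq_trans im)// leq_maxl.
  apply: e1; apply: e3; apply/mkseqP => i im; apply: e.
  by rewrite (leq_trans im)// leq_maxr.
exists K, (fun w i => w (c 0%N i)); split=> //.
- apply: salg_preimage_sub; first exact: smallest_sigma_algebra.
  by move=> _ [s _ <-]; exact: finitary_baire (finitary_prefix (eq^~ s) _ _).
- move=> x w /KG Gw; exists (fun i => w (c 1%N i)) => n.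
  by rewrite FG; exact: Gw.
- move=> x y [z Fz].
  exists (fun j => if unpickle j is Some (k, i) then
      (if k is 0%N then y i else z i) else 0%N); apply/KG => n.
  have := Fz n; rewrite FG /=; congr (G _ _ x).
    by apply/mkseqP => i _; rewrite /c pickleK.
  by apply/funext => i; rewrite /c pickleK.
Qed.

End baire_projection.

(** Composing with [p] moves the section variable to Baire space. Surjectivity and measurable
    preimages are all that is asked of [p], since a section is nonempty exactly when its inverse
    image is. *)
Lemma proj_scheme (T U : Type) (M : set (set T)) (N : set (set U))
    (p : (nat -> nat) -> U) (A : set (T * U)) :
  sigma_algebra setT M -> (forall u, exists y, p y = u) ->
  (forall B, N B -> baire_sigma (p @^-1` B)) -> suslin (prod_sigma M N) A ->
  exists F q, [/\ forall s, M (F s),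
    forall B, N B -> baire_sigma (q @^-1` B),
    forall x w, (forall n, F (mkseq w n) x) -> A (x, q w) &
    forall x u, A (x, u) -> exists w : nat -> nat, forall n, F (mkseq w n) x].
Proof.
move=> sM surj mp sA.
have [|F [q [MF mq Fq qF]]] := @proj_baire_scheme _ _ sM [set z | A (z.1, p z.2)].
  apply: (suslin_preimage (g := fun z => (z.1, p z.2)) _ sA).
  apply: prod_sigma_preimage; first exact: prod_sigma_algebra.
    move=> B MB; rewrite (_ : _ @^-1` _ = B `*` setT); last by apply/seteqP; split=> // z [].
    by apply: prod_sigma_rect => //; apply: salg_setT; exact: smallest_sigma_algebra.
  move=> B NB; rewrite (_ : _ @^-1` _ = setT `*` (p @^-1` B)); last by apply/seteqP; split=> // z [].
  by apply: prod_sigma_rect; [exact: salg_setT|exact: mp].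
exists F, (p \o q); split=> //.
- by move=> B NB; rewrite comp_preimage; apply: mq; exact: mp.
- by move=> x u Au; have [y yu] := surj u; apply: (qF x y); rewrite /= yu.
Qed.

Lemma suslin_proj (T U : Type) (M : set (set T)) (N : set (set U))
    (p : (nat -> nat) -> U) (A : set (T * U)) :
  sigma_algebra setT M -> (forall u, exists y, p y = u) ->
  (forall B, N B -> baire_sigma (p @^-1` B)) -> suslin (prod_sigma M N) A ->
  suslin M [set x | exists u, A (x, u)].
Proof.
move=> sM surj mp /(proj_scheme sM surj mp)[F [q [MF _ Fq qF]]].
exists F => //; apply/seteqP; split=> x; first by move=> [u /qF].
by move=> [w /Fq ?]; exists (q w).
Qed.

(** * Capacitability and measurability of Souslin sets *)

(** Dependent choice on the tree of finite sequences, for both the bounding sequence of the capacity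
    argument and the branch of Koenig's lemma. *)
Lemma seq_recursion (Q : seq nat -> Prop) : Q [::] ->
  (forall s, Q s -> exists k, Q (rcons s k)) ->
  exists y : nat -> nat, forall n, Q (mkseq y n).
Proof.
move=> Q0 QS.
have /choice[k Qk] : forall s, exists k, Q s -> Q (rcons s k).
  move=> s; have [/QS[k]|nQ] := pselect (Q s); first by exists k.
  by exists 0%N.
pose s n := iter n (fun s => rcons s (k s)) [::].
have sE n : mkseq (k \o s) n = s n by elim: n => //= n IH; rewrite mkseqS IH.
exists (k \o s) => n; rewrite sE; elim: n => //= n; exact: Qk.
Qed.

Definition pointwise_le (t s : seq nat) : Prop :=
  size t = size s /\ forall i, (i < size s)%N -> (nth 0%N t i <= nth 0%N s i)%N.

Definition antimonotone (T : Type) (F : seq nat -> set T) : Prop :=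
  forall s k, F (rcons s k) `<=` F s.

Lemma antimonotone_take T (F : seq nat -> set T) : antimonotone F ->
  forall n s, F s `<=` F (take n s).
Proof.
move=> aF n; elim/last_ind => // s k IH; rewrite -cats1 take_cat.
case: ltnP => [ltn|]; first by rewrite cats1; apply: subset_trans IH.
case: (n - size s)%N => [|m] _; last by rewrite take_oversize.
by rewrite take0 cats0 cats1.
Qed.

Lemma suslin_antimonotone T (M : set (set T)) A : interclosed M -> suslin M A ->
  exists2 F : seq nat -> set T, (forall s, M (F s)) /\ antimonotone F &
    A = [set x | exists y : nat -> nat, forall n, F (mkseq y n) x].
Proof.
move=> MI [F MF ->].
(* Intersecting over all prefixes of [s], itself included, makes the scheme decrease and keeps its
   branches; the conjunct [True] matches the form of [interclosed_bigcap]. *)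
exists (fun s => \bigcap_(i in [set i | (i < (size s).+1)%N /\ True]) F (take i s)).
  split=> [s|s k x Fx i [isz _]]; first exact: (interclosed_bigcap _ _ MI).
  have := Fx i; rewrite size_rcons -cats1 takel_cat; last by rewrite -ltnS.
  by apply; split=> //; exact: ltnW.
have tE y n i : (i <= n)%N -> take i (mkseq y n) = mkseq y i :> seq nat.
  by move=> le; rewrite /mkseq -map_take take_iota (minn_idPl le).
apply/seteqP; split=> x [y Fx]; exists y => n.
  by move=> i [+ _] /=; rewrite ltnS size_mkseq => /tE ->.
by have := Fx n n; rewrite size_mkseq tE//; apply.
Qed.

Section scheme_bound.
Variables (T : Type) (F : seq nat -> set T).

Definition bounded_union (s : seq nat) : set T :=
  [set x | exists2 t, pointwise_le t s & F t x].

(** The sequences below [s] are finitely many, but over a sigma-algebra it is enough to run through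
    the codes of all sequences. *)
Lemma bounded_union_meas (M : set (set T)) s : sigma_algebra setT M ->
  (forall s, M (F s)) -> M (bounded_union s).
Proof.
move=> sM MF.
pose G n : set T := if @unpickle (seq nat) n is Some t then
  if `[< pointwise_le t s >] then F t else set0 else set0.
have -> : bounded_union s = \bigcup_n G n.
  apply/seteqP; split=> x.
    move=> [t ts Ftx]; exists (pickle t) => //; rewrite /G pickleK.
    by rewrite asboolT.
  move=> [n _]; rewrite /G; case: (unpickle n) => // t.
  by case: asboolP => // ts Ftx; exists t.
case: (sM) => M0 _ MU; apply: MU => n; rewrite /G.
by case: (unpickle n) => [t|]; [case: asboolP => _|].
Qed.

Lemma pointwise_le_mkseqS t (a : nat -> nat) n :
  pointwise_le t (mkseq a n.+1) -> pointwise_le (take n t) (mkseq a n).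
Proof.
rewrite /pointwise_le !size_mkseq => -[szt le]; split.
  by rewrite size_takel// szt.
move=> i lin; rewrite nth_take// nth_mkseq//; have := le i.
by rewrite nth_mkseq ?ltnS ?(ltnW lin) => [/(_ isT)|].
Qed.

Hypothesis aF : antimonotone F.

Lemma bounded_union_nincr a n :
  bounded_union (mkseq a n.+1) `<=` bounded_union (mkseq a n).
Proof.
move=> x [t ts Ftx]; exists (take n t); first exact: pointwise_le_mkseqS.
exact: antimonotone_take Ftx.
Qed.

Lemma bounded_union_nincr_le a m n : (m <= n)%N ->
  bounded_union (mkseq a n) `<=` bounded_union (mkseq a m).
Proof.
elim: n => [|n IH]; first by rewrite leqn0 => /eqP ->.
rewrite leq_eqVlt => /predU1P[->//|]; rewrite ltnS => /IH.
by apply: subset_trans; exact: bounded_union_nincr.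
Qed.

(* Koenig's lemma. *)
Lemma bounded_union_bigcap a :
  \bigcap_n bounded_union (mkseq a n) `<=`
  [set x | exists y : nat -> nat, forall n, F (mkseq y n) x].
Proof.
move=> x Bx.
pose good s := forall n, (size s <= n)%N ->
  exists t, [/\ pointwise_le t (mkseq a n), take (size s) t = s & F t x].
have [||y gy] := @seq_recursion good.
- by move=> n _; have [t ? ?] := Bx n I; exists t; rewrite take0.
- move=> s gs; apply: contrapT => /forallNP/= nk.
  have /choice[N nN] : forall k, exists n, (size s < n)%N /\
      forall t, pointwise_le t (mkseq a n) -> take (size s).+1 t = rcons s k ->
      ~ F t x.
    move=> k; apply: contrapT => /forallNP/= h; apply: (nk k) => n.
    rewrite size_rcons => lt; apply: contrapT => h'; apply: (h n); split=> //.
    by move=> t le e Ftx; apply: h'; exists t; split.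
  (* The digits allowed here are finitely many, so some level lies past the failure of every child;
     the node that [good] provides there extends one of these children. *)
  pose m := (\max_(k < (a (size s)).+1) N k).
  have [|t [tle ts Ftx]] := gs (maxn m (size s).+1).
    by rewrite leq_max leqnSn orbT.
  pose k := nth 0%N t (size s).
  have szt : size t = maxn m (size s).+1 by rewrite tle.1 size_mkseq.
  have st : (size s < size t)%N by rewrite szt leq_max leqnn orbT.
  have kle : (k < (a (size s)).+1)%N.
    rewrite ltnS; have [e le] := tle; have := le (size s); rewrite -e => /(_ st).
    by rewrite nth_mkseq// -szt.
  have Nk : (N k <= size t)%N.
    by rewrite szt leq_max; apply/orP; left; exact: (leq_bigmax (Ordinal kle)).
  have [sN /(_ (take (N k) t))] := nN k; apply.
  + split; first by rewrite size_takel// size_mkseq.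
    rewrite size_mkseq => i iN; rewrite nth_take// nth_mkseq//.
    have [e le] := tle; have := le i; rewrite -e nth_mkseq -?szt ?(leq_trans iN)//.
    by apply.
  + rewrite take_takel// (take_nth 0%N)// ts//.
  + exact: antimonotone_take Ftx.
exists y => n; have [] := gy n n; first by rewrite size_mkseq.
move=> t [[szt _]]; rewrite size_mkseq in szt *.
by rewrite take_oversize ?szt ?size_mkseq// => -> .
Qed.

End scheme_bound.

Lemma ex_invS_lt (R : realType) (e : R) : (0 < e)%R -> exists n, (n.+1%:R^-1 < e)%R.
Proof.
move=> e0; exists (Num.truncn (e^-1)); rewrite invf_plt ?posrE//.
by rewrite truncnS_gt// ltW// invr_gt0.
Qed.

Section outer.
Context d (T : measurableType d) (R : realType).
Variable mu : {measure set T -> \bar R}.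

Definition outer (A : set T) : \bar R :=
  ereal_inf [set mu B | B in [set B | measurable B /\ A `<=` B]].

Lemma outer_le A B : measurable B -> A `<=` B -> outer A <= mu B.
Proof. by move=> mB AB; apply: ereal_inf_lbound; exists B. Qed.

Lemma le_outer A B : A `<=` B -> outer A <= outer B.
Proof.
move=> AB; apply: ereal_inf_le_tmp => _ [C [mC BC] <-]; exists C => //.
by split=> //; exact: subset_trans BC.
Qed.

Lemma outer_measurable A : measurable A -> outer A = mu A.
Proof.
move=> mA; apply/eqP; rewrite eq_le outer_le//=; apply: le_ereal_inf_tmp.
by move=> _ [B [mB AB] <-]; rewrite le_measure ?inE.
Qed.

Hypothesis fmu : mu setT < +oo.

Let muT A : measurable A -> mu A < +oo.
Proof. by move=> mA; rewrite (le_lt_trans _ fmu)// le_measure ?inE. Qed.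

Lemma outer_fin_num A : outer A \is a fin_num.
Proof.
rewrite ge0_fin_numE; first by rewrite (le_lt_trans (outer_le _ (@subsetT _ A))).
by apply: le_ereal_inf_tmp => _ [B _ <-].
Qed.

Lemma outer_hull A : exists2 B, measurable B & A `<=` B /\ mu B = outer A.
Proof.
have /choice[B hB] : forall n, exists B, [/\ measurable B, A `<=` B &
    mu B < outer A + (n.+1%:R^-1)%:E].
  move=> n; have [||_ [B [mB AB] <-] lt] := @lb_ereal_inf_adherent _
      [set mu B | B in [set B | measurable B /\ A `<=` B]] n.+1%:R^-1.
  - by rewrite invr_gt0.
  - exact: outer_fin_num.
  - by exists B.
have mB : measurable (\bigcap_n B n).
  by apply: bigcapT_measurable => n; have [] := hB n.
have AB : A `<=` \bigcap_n B n by move=> x Ax n _; have [_ /(_ x Ax)] := hB n.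
exists (\bigcap_n B n) => //; split=> //.
apply/eqP; rewrite eq_le outer_le// andbT; apply/lee_addgt0Pr => e e0.
have [n ne] := ex_invS_lt e0.
have [mBn _ /ltW lt] := hB n.
rewrite (@le_trans _ _ (mu (B n)))//; first by rewrite le_measure ?inE// => x; apply.
by rewrite (le_trans lt)// leeD2l// lee_fin ltW.
Qed.

(** Measurable hulls of increasing sets need not increase, but the intersections [N n] of all later
    hulls do, and still contain [A n]; continuity from below of [mu] then applies. *)
Lemma outer_bigcup (A : nat -> set T) c : (forall n, A n `<=` A n.+1) ->
  (forall n, outer (A n) <= c) -> outer (\bigcup_n A n) <= c.
Proof.
move=> ndA Ac.
have /choice[B hB] : forall n, exists B, [/\ measurable B, A n `<=` B &
    mu B = outer (A n)].
  by move=> n; have [B ? [? ?]] := outer_hull (A n); exists B.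
pose N n := \bigcap_(j in [set j | (n <= j)%N]) B j.
have mN n : measurable (N n).
  by apply: bigcap_measurable => [|j _]; [exists n => /=|case: (hB j)].
have ndA' n j : (n <= j)%N -> A n `<=` A j.
  elim: j => [|j IH]; first by rewrite leqn0 => /eqP ->.
  rewrite leq_eqVlt => /predU1P[->//|]; rewrite ltnS => /IH.
  by move/subset_trans; apply.
have AN n : A n `<=` N n.
  by move=> x Ax j /= nj; have [_ + _] := hB j; apply; exact: ndA' Ax.
have mUN : measurable (\bigcup_n N n) by exact: bigcupT_measurable.
apply: (@le_trans _ _ (mu (\bigcup_n N n))).
  by apply: outer_le => //; apply: subset_bigcup.
have cvgN : mu (N n) @[n --> \oo] --> mu (\bigcup_n N n).
  apply: nondecreasing_cvg_mu => // m n mn; apply/subsetPset => x Nx j /= nj.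
  by apply: Nx => /=; exact: leq_trans nj.
apply: (cvge_to_le cvgN); apply: nearW => n /=; rewrite (le_trans _ (Ac n))//.
have [mB _ <-] := hB n; rewrite le_measure ?inE// => x; apply => /=.
exact: leqnn.
Qed.

Section capacity.
Variable F : seq nat -> set T.
Hypothesis mF : forall s, measurable (F s).
Hypothesis aF : antimonotone F.
Let A := [set x | exists y : nat -> nat, forall n, F (mkseq y n) x].

(** Bounding one more digit of the branches by [k] gives sets that increase with [k] to the previous
    one, so by [outer_bigcup] some [k] keeps the outer measure above [r]. Iteration yields [a]; the
    sets [As] need not be measurable, but each lies in the measurable [bounded_union]. *)
Lemma capacity r : r < outer A ->
  exists a, forall n, r <= mu (bounded_union F (mkseq a n)).
Proof.
move=> rA.
pose As s := [set x | exists2 y : nat -> nat,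
  pointwise_le (mkseq y (size s)) s & forall n, F (mkseq y n) x].
have [||a ra] := @seq_recursion (fun s => r < outer (As s)).
- rewrite (lt_le_trans rA)//; apply: le_outer => x [y Fy]; exists y => //.
- move=> s rs; apply: contrapT => /forallNP/= h; move: rs; apply/negP.
  rewrite -leNgt (@le_trans _ _ (outer (\bigcup_k As (rcons s k))))//.
    apply: le_outer => x [y [_ ys] Fy]; exists (y (size s)) => //; exists y => //.
    split; first by rewrite size_mkseq.
    rewrite size_rcons => i; rewrite ltnS leq_eqVlt => /predU1P[->|lt].
      by rewrite nth_mkseq// nth_rcons ltnn eqxx.
    rewrite nth_rcons lt nth_mkseq; last by rewrite ltnS ltnW.
    by move: (ys i lt); rewrite nth_mkseq.
  apply: outer_bigcup => k; last by rewrite leNgt; apply/negP; exact: h.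
  move=> x [y [_ ys] Fy]; exists y => //; split; first by rewrite size_mkseq !size_rcons.
  move=> i; rewrite size_rcons => ilt; have := ys i; rewrite !size_rcons => /(_ ilt) le.
  by rewrite (leq_trans le)// !nth_rcons; case: ltnP => // _; case: eqP.
exists a => n; rewrite -outer_measurable; last first.
  by apply: bounded_union_meas => //; exact: sigma_algebra_measurable.
rewrite ltW// (lt_le_trans (ra n))//; apply: le_outer => x [y ys Fy].
by exists (mkseq y (size (mkseq a n))).
Qed.

Lemma bounded_union_inner r a :
  (forall n, r <= mu (bounded_union F (mkseq a n))) ->
  exists2 C, measurable C & C `<=` A /\ r <= mu C.
Proof.
move=> rB; pose B n := bounded_union F (mkseq a n).
have mB n : measurable (B n).
  by apply: bounded_union_meas => //; exact: sigma_algebra_measurable.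
exists (\bigcap_n B n); first exact: bigcapT_measurable.
split; first exact: bounded_union_bigcap.
have cvgB : mu (B n) @[n --> \oo] --> mu (\bigcap_n B n).
  apply: nonincreasing_cvg_mu => //; [exact: muT|exact: bigcapT_measurable|].
  by move=> m n mn; apply/subsetPset; exact: bounded_union_nincr_le.
by apply: (cvge_to_ge cvgB); apply: nearW => n /=; exact: rB.
Qed.

(** The margin 1/(k+1) survives the decreasing limit over [n], where a strict inequality could be
    lost. The right-hand side involves only measurable sets, each determined by a finite prefix of
    [a]. *)
Lemma capacityP (r : R) : r%:E < outer A <->
  exists k a, forall n, r%:E + (k.+1%:R^-1)%:E <= mu (bounded_union F (mkseq a n)).
Proof.
split=> [rA|[k [a /bounded_union_inner[C mC [CA rC]]]]].
  have [k rk] : exists k, r%:E + (k.+1%:R^-1)%:E < outer A.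
    move: rA; rewrite -(fineK (outer_fin_num A)) lte_fin => rA.
    have : (0 < fine (outer A) - r)%R by rewrite subr_gt0.
    by move=> /ex_invS_lt[k lt]; exists k; rewrite -EFinD lte_fin -ltrBrDl.
  by exists k; exact: capacity.
apply: (@lt_le_trans _ _ (mu C)).
  by rewrite (lt_le_trans _ rC)// -EFinD lte_fin ltrDl invr_gt0.
by rewrite -outer_measurable//; exact: le_outer.
Qed.

End capacity.

(** [D] is a measurable hull, and capacity at the levels [outer A] minus 1/(n+1) provides inner sets
    whose union has the same finite measure. *)
Lemma suslin_measurable (A : set T) : suslin measurable A ->
  exists C D, [/\ measurable C, measurable D, C `<=` A, A `<=` D & mu (D `\` C) = 0].
Proof.
move=> /suslin_antimonotone[]; first exact/salg_interclosed/sigma_algebra_measurable.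
move=> F [mF aF] AE; have [D mD [AD muD]] := outer_hull A.
have /choice[C hC] : forall n, exists C, [/\ measurable C, C `<=` A &
    outer A - (n.+1%:R^-1)%:E <= mu C].
  move=> n; have [|a /(bounded_union_inner mF aF)[C mC [CA le]]] :=
      @capacity F mF (outer A - (n.+1%:R^-1)%:E).
    by rewrite -AE lteBlDr// lteDl ?outer_fin_num// lte_fin invr_gt0.
  by exists C; split=> //; rewrite AE.
have CA : \bigcup_n C n `<=` A by apply: bigcup_sub => n _; case: (hC n).
have mC : measurable (\bigcup_n C n).
  by apply: bigcupT_measurable => n; case: (hC n).
exists (\bigcup_n C n), D; split=> //.
have CD : \bigcup_n C n `<=` D by exact: subset_trans AD.
have -> : mu (D `\` \bigcup_n C n) = mu D - mu (\bigcup_n C n).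
  by rewrite measureD ?muT// setIC (setIidl CD).
rewrite muD.
suff -> : mu (\bigcup_n C n) = outer A by rewrite subee// outer_fin_num.
apply/eqP; rewrite eq_le; apply/andP; split.
  by rewrite -(outer_measurable mC) le_outer.
apply/lee_subgt0Pr => e e0.
have [n ne] := ex_invS_lt e0.
have [mCn _ le] := hC n.
rewrite (@le_trans _ _ (mu (C n)))//; last first.
  by rewrite le_measure ?inE//; exact: bigcup_sup.
by rewrite (le_trans _ le)// leeB// lee_fin ltW.
Qed.

End outer.

Lemma section_measurable (T : Type) (M : set (set T)) d (O : measurableType d)
    (R : realType) (P : probability O R) (A : set (T * O)) :
  sigma_algebra setT M -> prod_sigma M measurable A ->
  (forall x, measurable [set o | A (x, o)]) /\
  forall r, M [set x | r <= P [set o | A (x, o)]].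
Proof.
(* The measurable structure put on [T] needs a point, hence the separate case of an empty [T]. *)
move=> sM MA; have [[x0]|nT] := pselect (inhabited T); last first.
  split=> [x|r]; first by exfalso; apply: nT; exists.
  rewrite (_ : [set _ | _] = set0); first by case: sM.
  by apply/seteqP; split=> // x; exfalso; apply: nT; exists.
pose T' : pointedType :=
  HB.pack T (gen_eqMixin T) (gen_choiceMixin T) (isPointed.Build T x0).
pose S := g_sigma_algebraType (M : set (set T')).
have SM : @measurable _ S = M by exact: measurable_g_measurableTypeE.
have mA : measurable (A : set (S * O)).
  by rewrite measurable_prod_measurableType SM.
have sE x : xsection (A : set (S * O)) x = [set o | A (x, o)].
  by apply/seteqP; split=> o; rewrite /xsection /= inE.
split=> [x|r]; first by rewrite -sE; exact: measurable_xsection.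
have mf := measurable_fun_xsection P mA.
rewrite -SM -[X in measurable X]setTI.
rewrite (_ : [set _ | _] = (P \o xsection (A : set (S * O))) @^-1` `[r, +oo[%classic).
  by apply: mf => //; exact: measurable_realfun.emeasurable_itv.
by apply/seteqP; split=> x /=; rewrite in_itv/= andbT sE.
Qed.

(** In [capacityP] the bounding sequence [a] is itself a Souslin branch: for each [k] the conditions
    are measurable in [x] and read finite prefixes of [a]. *)
Lemma suslin_section (T : Type) (M : set (set T)) d (O : measurableType d)
    (R : realType) (P : probability O R) (A : set (T * O)) (r : R) :
  sigma_algebra setT M -> suslin (prod_sigma M measurable) A ->
  suslin M [set x | r%:E < outer P [set o | A (x, o)]].
Proof.
move=> sM /suslin_antimonotone[].
  exact/salg_interclosed/prod_sigma_algebra.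
move=> F [MF aF] ->.
pose Fx x s := [set o | F s (x, o)].
have mFx x s : measurable (Fx x s) by exact: (section_measurable P sM (MF s)).1.
have aFx x : antimonotone (Fx x) by move=> s k o; exact: aF.
have fP : P setT < +oo by rewrite probability_setT ltry.
rewrite (_ : [set _ | _] = \bigcup_k [set x | exists a, forall n,
    r%:E + (k.+1%:R^-1)%:E <= P [set o | bounded_union F (mkseq a n) (x, o)]]).
  apply: suslin_bigcup => [|k]; first exact: salg_interclosed.
  apply: (@suslin_finitary _ _ (fun n a => [set x |
    r%:E + (k.+1%:R^-1)%:E <= P [set o | bounded_union F (mkseq a n) (x, o)]])).
  - exact: salg_interclosed.
  - move=> n y; apply: (section_measurable P sM _).2.
    by apply: bounded_union_meas => //; exact: prod_sigma_algebra.
  - move=> n; exact: (finitary_prefix (fun s => [set x |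
      r%:E + (k.+1%:R^-1)%:E <= P [set o | bounded_union F s (x, o)]]) id).
apply/seteqP; split=> x.
  by move=> /(capacityP fP (mFx x) (aFx x))[k [a ra]]; exists k => //; exists a.
by move=> [k _ [a ra]]; apply/(capacityP fP (mFx x) (aFx x)); exists k, a.
Qed.

(** * Measurable selection *)

Section selection.
Context d (O : measurableType d) (R : realType) (P : {measure set O -> \bar R}).
Hypothesis fP : P setT < +oo.

Section leftmost.
Variable C : seq nat -> set O.
Hypothesis mC : forall s, measurable (C s).

Let next s o : nat :=
  if pselect (exists k, `[< C (rcons s k) o >]) is left ex then ex_minn ex else 0%N.

Let next_measurable s k : measurable [set o | next s o = k].
Proof.
pose E := C (rcons s k) `&` \bigcap_j (if (j < k)%N then ~` C (rcons s j) else setT).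
have mE : measurable E.
  apply: measurableI => //; apply: bigcapT_measurable => j.
  by case: ifP => _ //; exact: measurableC.
have mE0 : measurable (\bigcap_j ~` C (rcons s j)).
  by apply: bigcapT_measurable => j; exact: measurableC.
(* 0 is also the default of [next] where no child of [s] contains [o], which adds a piece when [k]
   is 0. *)
have -> : [set o | next s o = k] =
    E `|` (if k is 0%N then \bigcap_j ~` C (rcons s j) else set0).
  apply/seteqP; split=> o /=; rewrite /next; case: pselect => [ex|nex].
  - case: ex_minnP => m /asboolP Cm minm mk; left; rewrite /E -mk; split=> // j _.
    case: ifP => //= jm Cj; move: jm; apply/negP; rewrite -leqNgt.
    by apply: minm; apply/asboolP.
  - by move=> <-; right => j _ Cj; apply: nex; exists j; apply/asboolP.
  - case=> [[Ck Cj]|]; last first.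
      by case: k {E mE} => // h; have [j /asboolP Cj] := ex; case: (h j I).
    case: ex_minnP => m /asboolP Cm minm.
    apply/eqP; rewrite eqn_leq minm/=; last by apply/asboolP.
    by rewrite leqNgt; apply/negP => mk; have := Cj m I; rewrite mk.
  - case=> [[Ck _]|]; last by case: k {E mE}.
    by exfalso; apply: nex; exists k; apply/asboolP.
by apply: measurableU => //; case: k {E mE}.
Qed.

Lemma leftmost_branch : exists g : O -> nat -> nat,
  (forall B, baire_sigma B -> measurable (g @^-1` B)) /\
  forall o, C [::] o ->
    (forall s, C s o -> exists k, C (rcons s k) o) -> forall n, C (mkseq (g o) n) o.
Proof.
pose st o n := iter n (fun s => rcons s (next s o)) [::].
pose g o n := next (st o n) o.
have stE o n : mkseq (g o) n = st o n.
  by elim: n => //= n IH; rewrite mkseqS IH.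
exists g; split=> [|o C0 CS n].
  apply: salg_preimage_sub; first exact: sigma_algebra_measurable.
  move=> _ [s _ <-].
  rewrite (_ : _ @^-1` _ = [set o | st o (size s) = s]); last first.
    by apply/seteqP; split=> o /=; rewrite stE.
  elim/last_ind: s => [|s k IH].
    by rewrite (_ : [set _ | _] = setT)//; apply/seteqP; split.
  rewrite size_rcons.
  rewrite (_ : [set _ | _] = [set o | st o (size s) = s] `&` [set o | next s o = k]).
    exact: measurableI.
  apply/seteqP; split=> o /= => [/rcons_inj[e]|[e <-]]; last by rewrite e.
  by rewrite e => <-.
rewrite stE; elim: n => //= n IH; rewrite /next; case: pselect => [ex|].
  by case: ex_minnP => k /asboolP.
by case; have [k Ck] := CS _ IH; exists k; apply/asboolP.
Qed.

End leftmost.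

(* The set of points through which a branch extending [s] passes is Souslin,
   hence contains a measurable subset [C s] of full measure; off a null set the
   leftmost branch of the tree of the [s] with [C s o] is infinite. *)
Lemma scheme_selection (F : seq nat -> set O) : (forall s, measurable (F s)) ->
  exists (g : O -> nat -> nat) (N : set O),
    [/\ forall B, baire_sigma B -> measurable (g @^-1` B), measurable N, P N = 0 &
        forall o, ~ N o -> (exists w : nat -> nat, forall n, F (mkseq w n) o) ->
          forall n, F (mkseq (g o) n) o].
Proof.
move=> mF; have sO := @sigma_algebra_measurable _ O.
pose S t := [set o | exists w : nat -> nat,
  forall n, mkseq w (size t) = t /\ F (mkseq w n) o].
have sS t : suslin measurable (S t).
  apply: (@suslin_finitary _ _ (fun n w =>
      [set o | mkseq w (size t) = t /\ F (mkseq w n) o])).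
  - exact: salg_interclosed.
  - move=> n w; have [e|ne] := pselect (mkseq w (size t) = t).
      by rewrite (_ : [set _ | _] = F (mkseq w n))//; apply/seteqP; split=> // o [].
    by rewrite (_ : [set _ | _] = set0)//; apply/seteqP; split=> // o [].
  - move=> n.
    exact: (finitary2 (fun s s' => [set o | s = t /\ F s' o])
      (finitary_prefix id id (size t)) (finitary_prefix id id n)).
have /choice[C /choice[D CD]] := fun t => suslin_measurable fP (sS t).
have mN t : measurable (D t `\` C t) by have [? ? _ _ _] := CD t; exact: measurableD.
have mC t : measurable (C t) by have [] := CD t.
have [g [mg Cg]] := leftmost_branch mC.
pose Nn n := if @unpickle (seq nat) n is Some t then D t `\` C t else set0.
have mNn n : measurable (Nn n) by rewrite /Nn; case: (unpickle n).
exists g, (\bigcup_n Nn n); split=> //.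
- exact: bigcupT_measurable.
- apply/negligibleP; first exact: bigcupT_measurable.
  apply: negligible_bigcup => n; apply/negligibleP => //.
  rewrite /Nn; case: (unpickle n) => [t|]; last exact: measure0.
  by have [] := CD t.
- move=> o No [w Fw].
  have SC t : S t o -> C t o.
    move=> St; apply: contrapT => nC; apply: No; exists (pickle t) => //.
    by rewrite /Nn pickleK; split=> //; have [_ _ _ + _] := CD t; apply.
  have CS t : C t o -> S t o by have [_ _ + _ _] := CD t; apply.
  move=> n; have /CS : C (mkseq (g o) n) o.
    apply: Cg => [|s /CS[v Fv]]; first by apply: SC; exists w.
    exists (v (size s)); apply: SC; exists v => m; split; last by have [] := Fv m.
    by rewrite size_rcons mkseqS; have [-> _] := Fv 0%N.
  by move=> [v Fv]; have [+ Fvn] := Fv n; rewrite size_mkseq => <-.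
Qed.

Lemma suslin_selection (U : Type) (N : set (set U)) (p : (nat -> nat) -> U)
    (A : set (O * U)) :
  (forall u, exists y, p y = u) ->
  (forall B, N B -> baire_sigma (p @^-1` B)) ->
  suslin (prod_sigma measurable N) A ->
  exists (g : O -> U) (Z : set O),
    [/\ forall B, N B -> measurable (g @^-1` B), measurable Z, P Z = 0 &
        forall o, ~ Z o -> (exists u, A (o, u)) -> A (o, g o)].
Proof.
move=> surj mp /(proj_scheme (@sigma_algebra_measurable _ O) surj mp).
move=> [F [q [mF mq Fq qF]]]; have [g [Z [mg mZ Z0 Fg]]] := scheme_selection mF.
exists (q \o g), Z; split=> //.
- by move=> B NB; rewrite comp_preimage; apply: mg; exact: mq.
- by move=> o Zo [u /qF wF]; apply: Fq; exact: Fg.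
Qed.

End selection.

(** * Borel spaces *)

Definition countable_base (X : topologicalType) : Prop :=
  exists2 B : nat -> set X, forall n, open (B n) &
    forall (O : set X) x, open O -> O x -> exists n, B n x /\ B n `<=` O.

Lemma borel_sigma (X : topologicalType) : sigma_algebra setT (@borel X).
Proof. exact: smallest_sigma_algebra. Qed.

Lemma borel_open (X : topologicalType) (O : set X) : open O -> borel O.
Proof. exact: sub_sigma_algebra. Qed.

Lemma open_rect (X Y : topologicalType) (A : set X) (B : set Y) :
  open A -> open B -> open (A `*` B).
Proof.
move=> oA oB; rewrite (_ : A `*` B = fst @^-1` A `&` snd @^-1` B).
  apply: openI; apply: open_comp => // -[x y] _; [exact: cvg_fst|exact: cvg_snd].
by apply/seteqP; split=> z [].
Qed.

Lemma countable_base_prod (X Y : topologicalType) :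
  countable_base X -> countable_base Y -> countable_base (X * Y)%type.
Proof.
move=> [B oB hB] [C oC hC].
pose D n := if @unpickle (nat * nat)%type n is Some (i, j) then B i `*` C j else set0.
exists D => [n|O z oO Oz].
  by rewrite /D; case: unpickle => [[i j]|]; [exact: open_rect|exact: open0].
have : nbhs z O by exact: open_nbhs_nbhs.
case: z Oz => x y Oxy [[U V] /= [+ +] UVO]; rewrite !nbhsE.
move=> [U' [oU' U'x] U'U] [V' [oV' V'y] V'V].
have [i [Bx BU]] := hB _ _ oU' U'x; have [j [Cy CV]] := hC _ _ oV' V'y.
exists (pickle (i, j)); rewrite /D pickleK; split=> // -[a b] [/= Ba Cb].
by apply: UVO; split=> /=; [exact/U'U/BU|exact/V'V/CV].
Qed.

Lemma hausdorff_prod (X Y : topologicalType) :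
  hausdorff_space X -> hausdorff_space Y -> hausdorff_space (X * Y)%type.
Proof.
move=> hX hY [x y] [x' y'] cl; congr (_, _).
  apply: hX => A B nA nB.
  have [||[a b] [/= Aa Bb]] := cl (fst @^-1` A) (fst @^-1` B).
  - exact: (@cvg_fst _ _ (nbhs x) (nbhs y)).
  - exact: (@cvg_fst _ _ (nbhs x') (nbhs y')).
  by exists a.
apply: hY => A B nA nB.
have [||[a b] [/= Aa Bb]] := cl (snd @^-1` A) (snd @^-1` B).
- exact: (@cvg_snd _ _ (nbhs x) (nbhs y)).
- exact: (@cvg_snd _ _ (nbhs x') (nbhs y')).
by exists b.
Qed.

(** Countable bases make every open set of the product a countable union of open rectangles; the
    inclusion can fail in general spaces. *)
Lemma borel_prod (X Y : topologicalType) : countable_base X -> countable_base Y ->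
  @borel (X * Y)%type `<=` prod_sigma (@borel X) (@borel Y).
Proof.
move=> [B oB hB] [C oC hC]; apply: smallest_sub => [|O oO].
  exact: prod_sigma_algebra.
pose D n := if @unpickle (nat * nat)%type n is Some (i, j) then
  if `[< B i `*` C j `<=` O >] then B i `*` C j else set0 else set0.
have -> : O = \bigcup_n D n.
  apply/seteqP; split=> [[x y] Oxy|z [n _]]; last first.
    by rewrite /D; case: unpickle => // -[i j]; case: asboolP => // h /h.
  have : nbhs (x, y) O by exact: open_nbhs_nbhs.
  move=> [[U V] /= [+ +] UVO]; rewrite !nbhsE.
  move=> [U' [oU' U'x] U'U] [V' [oV' V'y] V'V].
  have [i [Bx BU]] := hB _ _ oU' U'x; have [j [Cy CV]] := hC _ _ oV' V'y.
  exists (pickle (i, j)) => //; rewrite /D pickleK asboolT// => -[a b] [/= Ba Cb].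
  by apply: UVO; split=> /=; [exact/U'U/BU|exact/V'V/CV].
have [P0 _ PU] := prod_sigma_algebra (@borel X) (@borel Y).
apply: PU => n; rewrite /D; case: unpickle => // -[i j].
by case: asboolP => // _; apply: prod_sigma_rect; exact: borel_open.
Qed.

(** If every cylinder around [y] left [A], points chosen outside [A] in these cylinders would
    converge to [y] coordinatewise, that is, in the product topology. *)
Lemma baire_nbhs (y : baire_space) (A : set baire_space) : nbhs y A ->
  exists n, forall y' : nat -> nat, mkseq y' n = mkseq y n -> A y'.
Proof.
move=> nA; apply: contrapT => /forallNP h.
have /choice[u hu] : forall n, exists y' : nat -> nat,
    mkseq y' n = mkseq y n /\ ~ A y'.
  by move=> n; have /existsNP[y' /not_implyP] := h n; exists y'.
have uy : (u : nat -> baire_space) @ \oo --> y.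
  apply/cvg_sup => i U [V] [[W] oW <-] WfN WU.
  apply: (filterS WU); rewrite nbhs_simpl; exists i.+1 => // n /= ilt.
  by have /mkseqP e := (hu n).1; rewrite /= e.
by have [N _ /(_ N (leqnn _))] := uy _ nA; apply: (hu N).2.
Qed.

(* A point lies in [range g] as soon as it is adherent to the images under [g]
   of all the cylinders around some [y]. *)
Lemma analytic_suslin (X : topologicalType) (A : set X) : hausdorff_space X ->
  analytic A -> suslin (@borel X) A.
Proof.
move=> hX [->|[g cg ->]].
  by apply: sub_suslin; have [] := @borel_sigma X.
exists (fun s => closure (g @` [set y : nat -> nat | mkseq y (size s) = s])).
  move=> s; set C := closure _; rewrite -(setCK C).
  apply: (salg_setC (@borel_sigma X)); apply: borel_open; apply: closed_openC.
  exact: closed_closure.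
apply/seteqP; split=> x.
  by move=> [y _ <-]; exists y => n; apply: subset_closure; exists y => //=; rewrite size_mkseq.
move=> [y gx]; exists y => //; apply: hX => U V nU nV.
have [n nyU] := baire_nbhs (cg y _ nU).
have [_ [[y' /= ey' <-] Vy']] := gx n V nV.
by exists (g y'); split=> //; apply: nyU; rewrite size_mkseq in ey'.
Qed.

Section borel_space_theory.
Variables (R : realType).

Section polish.
Variable Y : completePseudoMetricType R.
Hypothesis pY : polish Y.

Lemma dense_seq : exists dn : nat -> Y,
  forall (y : Y) (e : R), (0 < e)%R -> exists n, ball y e (dn n).
Proof.
have [_ [D cD dD]] := pY.
have /countable_injP[f finj] := cD.
exists (fun n => xget point [set x | D x /\ f x = n]) => y e e0.
have [|x [ex Dx]] := dD (interior (ball y e)) _ (open_interior _).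
  by exists y; exact: nbhsx_ballx.
exists (f x); case: xgetP => [z _ [Dz fz]|/(_ x)[]//].
by rewrite (finj z x) ?inE//; exact: interior_subset.
Qed.

Lemma polish_countable_base : countable_base Y.
Proof.
have [dn hd] := dense_seq.
exists (fun n => if @unpickle (nat * nat)%type n is Some (i, k) then
    interior (ball (dn i) (2 * k.+1%:R^-1)%R) else set0) => [n|O y oO Oy].
  by case: unpickle => [[i k]|]; [exact: open_interior|exact: open0].
have /nbhs_ballP[e /= e0 eO] : nbhs y O by exact: open_nbhs_nbhs.
(* With rho = 1/(k+1), the center lies within rho of [y], so [y] is interior to the ball of radius 2
   rho, whose points are within 3 rho < [e] of [y]. *)
have [k ke] := @ex_invS_lt R (e / 3) ltac:(by rewrite divr_gt0).
have k0 : (0 < k.+1%:R^-1 :> R)%R by rewrite invr_gt0.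
have [i hi] := hd y _ k0.
exists (pickle (i, k)); rewrite pickleK; split.
  apply/nbhs_ballP; exists (k.+1%:R^-1)%R => //= z yz.
  by rewrite mulr2n mulrDl !mul1r; apply: ball_triangle yz; exact: ball_sym.
move=> z /interior_subset dz; apply: eO.
apply: (@le_ball _ _ y (k.+1%:R^-1 + 2 * k.+1%:R^-1)).
  by move: (k.+1%:R^-1)%R ke => r ke; lra.
exact: ball_triangle hi dz.
Qed.

(** A branch lists points of a dense sequence. Those with an explicit Cauchy rate are [good] and go
    to their limit, the others to [dn 0]; the fixed rate makes goodness a countable conjunction of
    conditions on finitely many digits. *)
Lemma polish_surjection : exists q : (nat -> nat) -> Y,
  (forall x, exists y, q y = x) /\
  forall B, borel B -> baire_sigma (q @^-1` B).
Proof.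
have [dn hd] := dense_seq; have [hY _] := pY.
pose r n : R := (n.+1%:R^-1)%R.
have r0 n : (0 < r n)%R by rewrite invr_gt0.
have rle n m : (n <= m)%N -> (r m <= r n)%R.
  by move=> nm; rewrite lef_pV2 ?posrE// ler_nat.
pose good y := forall n m, (n <= m)%N -> ball (dn (y n)) (r n) (dn (y m)).
have good_cvg y : good y -> cvg ((dn \o y) @ \oo).
  move=> gy; apply/cauchy_cvgP/cauchy_exP => e /ex_invS_lt[n ne].
  exists (dn (y n)); exists n => // m /= nm.
  by apply: (le_ball (ltW ne)); exact: gy.
pose q y := if `[< good y >] then lim ((dn \o y) @ \oo) else dn 0%N.
have qball y n : good y -> ball (dn (y n)) (2 * r n)%R (q y).
  move=> gy; rewrite /q asboolT//.
  have cy : (dn \o y) x @[x --> \oo] --> lim ((dn \o y) @ \oo) by exact: good_cvg.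
  have [N _ hN] := cvg_ball cy (r0 n).
  have := hN (maxn n N) (leq_maxr _ _) => /= /ball_sym h.
  by rewrite mulr2n mulrDl !mul1r; apply: ball_triangle h; apply: gy; exact: leq_maxl.
exists q; split=> [x|].
  (* Half of [r n], so that approximations of ranks [n <= m] are within [r n] of each other. *)
  have /choice[y hy] : forall n, exists i, ball x (r n / 2)%R (dn i).
    by move=> n; apply: hd; rewrite divr_gt0.
  have gy : good y.
    move=> n m nm; have := ball_triangle (ball_sym (hy n)) (hy m).
    by apply: le_ball; have := rle _ _ nm; lra.
  exists y; rewrite /q asboolT//.
  apply/cvg_lim => //; apply/cvg_ballP => e /ex_invS_lt[n ne].
  exists n => // m /= nm; apply: le_ball (hy m).
  by have : (r n < e)%R := ne; have := rle _ _ nm; have := r0 m; lra.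
have sB := smallest_sigma_algebra setT (range (fun s =>
  [set y : nat -> nat | mkseq y (size s) = s])).
have Mp (p : Prop) : baire_sigma [set _ | p].
  by apply: finitary_baire; exact: finitary_cst.
have goodM : baire_sigma [set y | good y].
  rewrite (_ : [set _ | _] = \bigcap_n \bigcap_m [set y : nat -> nat |
      (n <= m)%N -> ball (dn (y n)) (r n) (dn (y m))]).
    apply: (salg_bigcap sB) => n; apply: (salg_bigcap sB) => m.
    apply: finitary_baire => y; exists (maxn n m).+1 => y' /mkseqP e.
    by rewrite !e// ltnS ?leq_maxl ?leq_maxr.
  by apply/seteqP; split=> [y h n _ m _|y h n m]; [exact: h|exact: (h n I m I)].
apply: salg_preimage_sub => // O oO.
(* Quantifying over all good branches with the same prefix makes membership in [E n] depend on [n]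
   digits only. *)
pose E (n : nat) : set (nat -> nat) :=
  [set y | forall y', good y' -> mkseq y' n = mkseq y n -> O (q y')].
have -> : q @^-1` O = ([set y | good y] `&` \bigcup_n E n) `|`
    (~` [set y | good y] `&` [set _ | O (dn 0%N)]).
  apply/seteqP; split=> y /=.
    move=> Oq; have [gy|ngy] := pselect (good y); [left|right].
      split=> //; have /nbhs_ballP[e /= e0 eO] : nbhs (q y) O by exact: open_nbhs_nbhs.
      (* Good branches sharing digit [n] have limits within [2 * r n] of the same point, hence
         within [4 * r n] of each other. *)
      have [n ne] := @ex_invS_lt R (e / 4) ltac:(by rewrite divr_gt0).
      exists n.+1 => // y' gy' /mkseqP e'; apply: eO.
      have := qball y' n gy'; rewrite e'// => /(ball_triangle (ball_sym (qball y n gy))).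
      by apply: le_ball; have : (r n < e / 4)%R := ne; lra.
    by split=> //; move: Oq; rewrite /q asboolF.
  move=> [[gy [n _ /(_ y gy)]]|[ngy Od]]; first exact.
  by rewrite /q asboolF.
apply: (salg_setU sB); apply: (salg_interclosed sB).2 => //; last first.
- exact: Mp.
- exact: (salg_setC sB).
case: (sB) => _ _ bU; apply: bU => n.
apply: finitary_baire => y; exists n => y' e; apply/propext.
by split=> h z gz ez; apply: h => //; rewrite ez e.
Qed.

End polish.

Variable X : topologicalType.
Hypothesis bX : borel_space R X.

Lemma borel_space_hausdorff : hausdorff_space X.
Proof.
have [Y [i [[hY _] inji ci _ _]]] := bX; move=> x y cl; apply: inji; apply: hY => A B nA nB.
by have [z [Az Bz]] := cl _ _ (ci x _ nA) (ci y _ nB); exists (i z).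
Qed.

Lemma borel_space_countable_base : countable_base X.
Proof.
have [Y [i [pY inji ci oi _]]] := bX; have [B oB hB] := polish_countable_base pY.
exists (fun n => i @^-1` B n) => [n|O x /oi[U oU ->] Ux].
  by move/continuousP: ci; apply.
by have [n [Bx BU]] := hB _ _ oU Ux; exists n; split=> // z; exact: BU.
Qed.

(** The surjection onto the ambient Polish space is pulled back along [i], branches that miss
    [range i] being sent to [x0]. This case distinction is measurable because [range i] is Borel. *)
Lemma borel_space_surjection (x0 : X) : exists p : (nat -> nat) -> X,
  (forall x, exists y, p y = x) /\
  forall B, borel B -> baire_sigma (p @^-1` B).
Proof.
have [Y [i [pY inji ci oi bi]]] := bX; have [q [sq mq]] := polish_surjection pY.
pose p y := if pselect (exists x, i x = q y) is left h then sval (cid h) else x0.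
have pE y x : i x = q y -> p y = x.
  move=> e; rewrite /p; case: pselect => [h|[]]; last by exists x.
  by apply: inji; case: (cid h) => /= z ->.
exists p; split=> [x|]; first by have [y e] := sq (i x); exists y; exact: pE.
have sB := smallest_sigma_algebra setT (range (fun s =>
  [set y : nat -> nat | mkseq y (size s) = s])).
apply: salg_preimage_sub => // _ /oi[U oU ->].
have -> : p @^-1` (i @^-1` U) = q @^-1` (U `&` range i) `|`
    (q @^-1` (~` range i) `&` [set _ | U (i x0)]).
  apply/seteqP; split=> y /=.
    rewrite {1}/p; case: pselect => [h|nh] /= Ui; [left|right].
      by case: (cid h) Ui => x /= <- Ux; split=> //; exists x.
    by split=> // -[x _ e]; apply: nh; exists x.
  move=> [[Uq [x _ e]]|[nq Ux0]]; first by rewrite (pE _ _ e) e.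
  rewrite /p; case: pselect => // h; exfalso; apply: nq.
  by have [x e] := h; exists x.
apply: (salg_setU sB).
  by apply: mq; apply: (salg_interclosed (@borel_sigma _)).2 => //; exact: borel_open.
apply: (salg_interclosed sB).2.
  by apply: mq; exact: (salg_setC (@borel_sigma _)).
by apply: finitary_baire; exact: finitary_cst.
Qed.

End borel_space_theory.

(** * Functions with Souslin strict sublevel sets *)

Definition lsa (R : realType) (T : Type) (M : set (set T)) (h : T -> \bar R) : Prop :=
  forall c : R, suslin M [set x | h x < c%:E].

Section lsa_theory.
Variables (R : realType) (T : Type) (M : set (set T)).
Hypothesis sM : sigma_algebra setT M.
Let MI := salg_interclosed sM.
Implicit Types h : T -> \bar R.

Lemma lsa_comp (U : Type) (N : set (set U)) (g : T -> U) (h : U -> \bar R) :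
  (forall B, N B -> M (g @^-1` B)) -> lsa N h -> lsa M (h \o g).
Proof. by move=> gN lh c; exact: (suslin_preimage gN (lh c)). Qed.

Lemma suslin_prop (p : Prop) : suslin M [set _ | p].
Proof.
apply: sub_suslin; have [hp|hp] := pselect p.
  rewrite (_ : [set _ | _] = setT); last by apply/seteqP; split.
  exact: salg_setT.
rewrite (_ : [set _ | _] = set0); last by apply/seteqP; split.
by case: sM.
Qed.

Lemma lsa_cst (a : \bar R) : lsa M (fun=> a).
Proof. by move=> c; exact: suslin_prop. Qed.

(** A rational strictly between [h1 x] and [c - h2 x] splits the strict inequality into two;
    nonnegativity excludes [-oo]. *)
Lemma lsa_add h1 h2 : (forall x, 0 <= h1 x) -> (forall x, 0 <= h2 x) ->
  lsa M h1 -> lsa M h2 -> lsa M (fun x => h1 x + h2 x).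
Proof.
move=> h10 h20 l1 l2 c.
pose q n : R := if @unpickle rat n is Some r then ratr r else 0%R.
rewrite (_ : [set _ | _] = \bigcup_n
    ([set x | h1 x < (q n)%:E] `&` [set x | h2 x < (c - q n)%:E])).
  apply: suslin_bigcup => // n.
  by apply: (suslin_interclosed MI).2; [exact: l1|exact: l2].
apply/seteqP; split=> x; last first.
  by move=> [n _ [/= lt1 lt2]]; have := lteD lt1 lt2; rewrite -EFinD subrKC.
rewrite /=; have := h10 x; have := h20 x.
case e1: (h1 x) => [r1||]//; case e2: (h2 x) => [r2||]//; rewrite ?addye// ?addey//.
rewrite -EFinD lte_fin => _ _; rewrite -ltrBrDr => /rat_in_itvoo[s].
rewrite in_itv /= => /andP[rs sr]; exists (pickle s) => //.
by rewrite /q pickleK; split; rewrite /= ?e1 ?e2 lte_fin// ltrBrDl -ltrBrDr.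
Qed.

Lemma lsa_sum (I : Type) (s : seq I) (h : I -> T -> \bar R) :
  (forall i x, 0 <= h i x) -> (forall i, lsa M (h i)) ->
  lsa M (fun x => \sum_(i <- s) h i x).
Proof.
move=> h0 lh; elim: s => [|i s IH].
  by under eq_fun do rewrite big_nil; exact: lsa_cst.
under eq_fun do rewrite big_cons.
by apply: lsa_add => // x; exact: sume_ge0.
Qed.

(** A supremum below [c] leaves a margin 1/(k+1) common to all [n]; mere strict bounds by [c] would
    allow a supremum equal to [c]. *)
Lemma lsa_sup (h : nat -> T -> \bar R) : (forall n x, 0 <= h n x) ->
  (forall n, lsa M (h n)) -> lsa M (fun x => ereal_sup (range (h ^~ x))).
Proof.
move=> h0 lh c.
rewrite (_ : [set _ | _] = \bigcup_k \bigcap_n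
    [set x | h n x < (c - k.+1%:R^-1)%R%:E]).
  apply: suslin_bigcup => // k; apply: suslin_bigcap => // n; exact: lh.
apply/seteqP; split=> x; last first.
  move=> [k _ hx]; apply: (@le_lt_trans _ _ (c - k.+1%:R^-1)%R%:E).
    by apply: ge_ereal_sup => _ [n _ <-]; exact/ltW/hx.
  by rewrite lte_fin ltrBlDr ltrDl invr_gt0.
rewrite /= => ltc.
have le n : h n x <= ereal_sup (range (h ^~ x)) by apply: ereal_sup_ubound; exists n.
have := le_trans (h0 0%N x) (le 0%N); move: ltc le; case: (ereal_sup _) => [s| |]//.
rewrite lte_fin -subr_gt0 => /ex_invS_lt[k hk] le _; exists k => // n _ /=.
by apply: le_lt_trans (le n) _; rewrite lte_fin ltrBrDl -ltrBrDr.
Qed.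

Lemma lsa_inf (h : nat -> T -> \bar R) :
  (forall n, lsa M (h n)) -> lsa M (fun x => ereal_inf (range (h ^~ x))).
Proof.
move=> lh c; rewrite (_ : [set _ | _] = \bigcup_n [set x | h n x < c%:E]).
  by apply: suslin_bigcup => // n; exact: lh.
apply/seteqP; split=> x; first by move=> /ereal_inf_lt[_ [n _ <-] lt]; exists n.
move=> [n _ /=]; apply: le_lt_trans; apply: ereal_inf_lbound; by exists n.
Qed.

Lemma lsa_series (h : nat -> T -> \bar R) : (forall n x, 0 <= h n x) ->
  (forall n, lsa M (h n)) -> lsa M (fun x => \sum_(0 <= n <oo) h n x).
Proof.
move=> h0 lh.
rewrite (_ : (fun=> _) = fun x => ereal_sup (range (fun n => \sum_(0 <= i < n) h i x))).
  apply: lsa_sup => [n x|n]; first exact: sume_ge0.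
  exact: lsa_sum.
apply/funext => x; apply/cvg_lim => //; apply: ereal_nondecreasing_cvgn.
by move=> m n mn; apply: lee_sum_nneg_natr.
Qed.

Lemma lsa_infU (U : Type) (N : set (set U)) (p : (nat -> nat) -> U)
    (h : T * U -> \bar R) : (forall u, exists y, p y = u) ->
  (forall B, N B -> baire_sigma (p @^-1` B)) -> lsa (prod_sigma M N) h ->
  lsa M (fun x => ereal_inf (range (fun u => h (x, u)))).
Proof.
move=> sp mp lh c.
rewrite (_ : [set _ | _] = [set x | exists u, [set z | h z < c%:E] (x, u)]).
  exact: (suslin_proj sM sp mp (lh c)).
apply/seteqP; split=> x; first by move=> /ereal_inf_lt[_ [u _ <-] lt]; exists u.
move=> [u /=]; apply: le_lt_trans; apply: ereal_inf_lbound; by exists u.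
Qed.

End lsa_theory.

(** * Expectations *)

(** [h'] is rebuilt from measurable inner approximations [C n] of the sublevel sets at rational
    levels. It dominates [h] everywhere, with equality wherever no approximation misses the point,
    that is, off a countable union of null sets. *)
Lemma lsa_measurable_version d (O : measurableType d) (R : realType)
    (mu : {measure set O -> \bar R}) (h : O -> \bar R) : mu setT < +oo ->
  (forall o, 0 <= h o) -> lsa measurable h ->
  exists (h' : O -> \bar R) (N : set O),
    [/\ measurable_fun setT h', forall o, 0 <= h' o, measurable N, mu N = 0 &
        forall o, ~ N o -> h o = h' o].
Proof.
move=> fmu h0 lh.
pose q n : R := if @unpickle rat n is Some r then ratr r else 0%R.
have /choice[C /choice[D CD]] := fun n => suslin_measurable fmu (lh (q n)).
have mC n : measurable (C n) by have [] := CD n.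
have Ch n : C n `<=` [set o | h o < (q n)%:E] by have [] := CD n.
have mN n : measurable (D n `\` C n) by have [? ? _ _ _] := CD n; exact: measurableD.
pose h' o := ereal_inf [set (q n)%:E | n in [set n | C n o]].
exists h', (\bigcup_n (D n `\` C n)); split.
- apply: (measurability _ (ErealGenInftyO.measurableE R)) => _ [_ [c ->] <-].
  rewrite setTI (_ : _ @^-1` _ = \bigcup_n (if (q n < c)%R then C n else set0)).
    by apply: bigcupT_measurable => n; case: ifP.
  apply/seteqP; split=> o /=; rewrite in_itv/=.
    by move=> /ereal_inf_lt[_ [n Cn <-]]; rewrite lte_fin => qc; exists n => //; rewrite qc.
  move=> [n _]; case: ifP => // qc Cn.
  by apply: (@le_lt_trans _ _ (q n)%:E); [apply: ereal_inf_lbound; exists n|].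
- move=> o; apply: le_ereal_inf_tmp => _ [n Cn <-].
  by rewrite (le_trans (h0 o))// ltW//; exact: Ch.
- exact: bigcupT_measurable.
- apply/negligibleP; first exact: bigcupT_measurable.
  by apply: negligible_bigcup => n; apply/negligibleP => //; have [] := CD n.
- move=> o No; have hC n : h o < (q n)%:E -> C n o.
    move=> lt; apply: contrapT => nC; apply: No; exists n => //; split=> //.
    by have [_ _ _ + _] := CD n; apply.
  apply/eqP; rewrite eq_le; apply/andP; split.
    by apply: le_ereal_inf_tmp => _ [n /Ch/ltW ? <-].
  have := h0 o; case e : (h o) => [r| |]// _; last by rewrite leey.
  apply/lee_addgt0Pr => e0 e00.
  have [s] := @rat_in_itvoo R r (r + e0) ltac:(by rewrite ltrDl).
  rewrite in_itv /= => /andP[rs sr].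
  apply: (@le_trans _ _ (q (pickle s))%:E); last first.
    by rewrite /q pickleK -EFinD lee_fin ltW.
  apply: ereal_inf_lbound; exists (pickle s) => //=; apply: hC.
  by rewrite e lte_fin /q pickleK.
Qed.

Section expect_theory.
Variables (R : realType) (Omega : ptopologicalType).
Variable P : probability (borelType Omega) R.
Local Notation O := (borelType Omega).
Implicit Types h : Omega -> \bar R.

(** Completeness makes [h] measurable for the Caratheodory sigma-field, as it equals the Borel
    function [h'] off a null set; the identity then pushes the completed measure forward to [P]. *)
Lemma expectE h (h' : O -> \bar R) (N : set O) : (forall o, 0 <= h o) ->
  measurable_fun setT h' -> (forall o, 0 <= h' o) -> measurable N -> P N = 0 ->
  (forall o, ~ N o -> h o = h' o) -> expect P h = \int[P]_o h' o.
Proof.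
move=> h0 mh' h'0 mN N0 hh'.
pose I := caratheodory_type (P^*)%mu.
pose cP := @completed_measure_extension _ _ _ P.
have mid : measurable_fun setT (id : I -> O).
  by move=> _ B mB; rewrite setTI; exact: caratheodory_measurable_mu_ext.
have mh'I : measurable_fun [set: I] (h' : I -> \bar R).
  exact: (measurableT_comp mh' mid).
have eq : ae_eq cP [set: I] (h' : I -> \bar R) (h : I -> \bar R).
  exists (N : set I); split.
  - exact: caratheodory_measurable_mu_ext.
  - by rewrite -N0; exact: measurable_mu_extE.
  - by move=> o /= ne; apply: contrapT => No; apply: ne => _; rewrite hh'.
have mhI : measurable_fun [set: I] (h : I -> \bar R).
  by apply: (ae_measurable_fun _ eq) => //; exact: measure_is_complete_caratheodory.
rewrite /expect -(ge0_ae_eq_integral _ mh'I mhI _ _ eq)//.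
transitivity (\int[pushforward cP (id : I -> O)]_o h' o).
  by rewrite ge0_integral_pushforward.
apply: eq_measure_integral => A mA _.
exact: measurable_mu_extE.
Qed.

Local Notation lsam := (lsa (@borel Omega)).

Let fP : P setT < +oo. Proof. by rewrite probability_setT ltry. Qed.

Lemma expect_version h : (forall o, 0 <= h o) -> lsam h ->
  exists (h' : O -> \bar R) (N : set O),
    [/\ measurable_fun setT h', forall o, 0 <= h' o, measurable N, P N = 0 &
        (forall o, ~ N o -> h o = h' o) /\ expect P h = \int[P]_o h' o].
Proof.
move=> h0 lh; have [h' [N [mh' h'0 mN N0 hh']]] := lsa_measurable_version fP h0 lh.
by exists h', N; split=> //; split=> //; exact: (expectE h0 mh' h'0 mN N0 hh').
Qed.

Lemma expect_ge0 h : (forall o, 0 <= h o) -> 0 <= expect P h.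
Proof. by move=> h0; exact: integral_ge0. Qed.

Lemma expectD h1 h2 : (forall o, 0 <= h1 o) -> (forall o, 0 <= h2 o) ->
  lsam h1 -> lsam h2 -> expect P (fun o => h1 o + h2 o) = expect P h1 + expect P h2.
Proof.
move=> h10 h20 l1 l2.
have [h1' [N1 [m1 h1'0 mN1 N10 [e1 ->]]]] := expect_version h10 l1.
have [h2' [N2 [m2 h2'0 mN2 N20 [e2 ->]]]] := expect_version h20 l2.
rewrite -ge0_integralD//; apply: (@expectE _ _ (N1 `|` N2)) => //.
- by move=> o; exact: adde_ge0.
- exact: emeasurable_funD.
- by move=> o; exact: adde_ge0.
- exact: measurableU.
- by apply/negligibleP; [exact: measurableU|apply: negligibleU; exact/negligibleP].
- by move=> o /not_orP[n1 n2]; rewrite e1 ?e2.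
Qed.

Lemma le_expect h1 h2 (Z : set O) : (forall o, 0 <= h1 o) -> (forall o, 0 <= h2 o) ->
  lsam h1 -> lsam h2 -> measurable Z -> P Z = 0 ->
  (forall o, ~ Z o -> h1 o <= h2 o) -> expect P h1 <= expect P h2.
Proof.
move=> h10 h20 l1 l2 mZ Z0 le12.
have [h1' [N1 [m1 h1'0 mN1 N10 [e1 ->]]]] := expect_version h10 l1.
have [h2' [N2 [m2 h2'0 mN2 N20 [e2 ->]]]] := expect_version h20 l2.
apply: ae_ge0_le_integral => //.
exists (N1 `|` N2 `|` Z); split.
- by do 2 apply: measurableU => //.
- apply/negligibleP; first by do 2 apply: measurableU => //.
  by do 2 (apply: negligibleU; last exact/negligibleP); exact/negligibleP.
- move=> o /= h; apply: contrapT => /not_orP[/not_orP[n1 n2] nZ].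
  by apply: h => _; rewrite -e1// -e2//; exact: le12.
Qed.

Lemma expect_cst (a : \bar R) : 0 <= a -> expect P (fun=> a) = a.
Proof.
move=> a0; rewrite (@expectE _ (cst a) set0)// integral_cst//.
by rewrite -[RHS]mule1; congr (_ * _); exact: probability_setT.
Qed.

Lemma outer_version (h h' : Omega -> \bar R) (N : set O) (c : R) :
  measurable_fun setT (h' : O -> \bar R) -> measurable N -> P N = 0 ->
  (forall o, ~ N o -> h o = h' o) ->
  outer P [set o | h o < c%:E] = P [set o | h' o < c%:E].
Proof.
move=> mh' mN N0 hh'.
have mA : measurable ([set o | h' o < c%:E] : set O).
  by rewrite -[X in measurable X]setTI; exact: emeasurable_fun_infty_o.
apply/eqP; rewrite eq_le; apply/andP; split.
  apply: (@le_trans _ _ (P ([set o | h' o < c%:E] `|` N))).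
    apply: outer_le; first exact: measurableU.
    by move=> o /= hc; have [No|/hh' e] := pselect (N o); [right|left; rewrite /= -e].
  apply: (le_trans (measureU2 _ _ _)) => //.
  by rewrite [X in _ + X](_ : _ = 0)// adde0.
apply: le_ereal_inf_tmp => _ [B [mB AB] <-].
apply: (@le_trans _ _ (P (B `|` N))).
  apply: le_measure; rewrite ?inE//; first exact: measurableU.
  by move=> o /= hc; have [No|/hh' e] := pselect (N o); [right|left; apply: AB; rewrite /= e].
apply: (le_trans (measureU2 _ _ _)) => //.
by rewrite [X in _ + X](_ : _ = 0)// adde0.
Qed.

End expect_theory.

(** * Upper Riemann sums of a nonnegative extended real *)

Section riemann.
Variables (R : realType) (d : R).
Hypothesis d0 : (0 < d)%R.

(** The series over [k] contributes [d] for each multiple of [d] in [0, r], zero included; counting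
    zero is what makes the sum an upper bound of [r], with excess at most [d]. *)
Let u (r : \bar R) (k : nat) : \bar R := if (d * k%:R)%:E <= r then d%:E else 0.

Let u_ge0 r k : 0 <= u r k.
Proof. by rewrite /u; case: ifP => // _; rewrite lee_fin ltW. Qed.

Let sum_u r n : (d * n%:R)%:E <= r -> \sum_(0 <= k < n.+1) u r k = (d * n.+1%:R)%:E.
Proof.
elim: n => [|n IH] le.
  by rewrite big_nat1 /u le mulr1.
rewrite big_nat_recr//= IH; last first.
  by rewrite (le_trans _ le)// lee_fin ler_pM2l// ler_nat.
by rewrite /u le -EFinD -[X in (_ + X)%R]mulr1 -mulrDr natr1.
Qed.

Lemma le_riemann r : 0 <= r -> r <= \sum_(0 <= k <oo) u r k.
Proof.
have le n : (d * n%:R)%:E <= r -> (d * n.+1%:R)%:E <= \sum_(0 <= k <oo) u r k.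
  by move=> /sum_u <-; apply: nneseries_lim_ge.
have lt t : t%:E <= (d * (Num.truncn (d^-1 * `|t|)).+1%:R)%:E.
  by rewrite lee_fin (le_trans (ler_norm _))// -ler_pdivrMl// ltW// truncnS_gt.
case: r le => [r| |]// le r0; last first.
  rewrite (eq_infty (x := \sum_(0 <= k <oo) u +oo k))// => t.
  by rewrite (le_trans (lt t))// le// leey.
apply: (le_trans (lt r)); apply: le; rewrite lee_fin -ler_pdivlMl// ger0_norm//.
by rewrite truncn_le// mulr_ge0// invr_ge0 ltW.
Qed.

Lemma riemann_le r : 0 <= r -> \sum_(0 <= k <oo) u r k <= r + d%:E.
Proof.
move=> r0; apply: lime_le; first exact: is_cvg_nneseries.
apply: nearW; elim=> [|n IH].
  by rewrite big_nil adde_ge0// lee_fin ltW.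
have [le|nle] := boolP ((d * n%:R)%:E <= r); last first.
  by rewrite big_nat_recr//= {2}/u (negbTE nle) adde0.
by rewrite sum_u// -natr1 mulrDr mulr1 EFinD leeD2r.
Qed.

End riemann.

Section expect_lsa.
Variables (R : realType) (Omega : ptopologicalType).
Variable P : probability (borelType Omega) R.
Local Notation O := (borelType Omega).

(* Upper Riemann sums of the layer-cake formula. *)
Lemma expect_riemann (h : Omega -> \bar R) : (forall o, 0 <= h o) ->
  lsa (@borel Omega) h ->
  expect P h = ereal_inf (range (fun m : nat => \sum_(0 <= k <oo)
    (m.+1%:R^-1)%:E * (1 - outer P [set o | h o < (m.+1%:R^-1 * k%:R)%:E]))).
Proof.
move=> h0 lh; have [h' [N [mh' h'0 mN N0 [e ->]]]] := expect_version P h0 lh.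
have m0 (m : nat) : (0 < m.+1%:R^-1 :> R)%R by rewrite invr_gt0.
pose A m k : set O := [set o | (m.+1%:R^-1 * k%:R)%:E <= h' o].
have mA m k : measurable (A m k).
  by rewrite -[X in measurable X]setTI; exact: emeasurable_fun_c_infty.
pose u m k o : \bar R :=
  if (m.+1%:R^-1 * k%:R)%:E <= h' o then (m.+1%:R^-1)%:E else 0.
have uE m k o : u m k o = (m.+1%:R^-1)%:E * (\1_(A m k) o)%:E.
  rewrite indicE /u; case: ifPn => hk; first by rewrite mem_set// mule1.
  by rewrite memNset ?mule0//; exact/negP.
have mind m k : measurable_fun setT (fun o : O => (\1_(A m k) o)%:E : \bar R).
  by apply/measurable_EFinP; exact: measurable_indic.
have mu m k : measurable_fun setT (u m k : O -> \bar R).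
  by rewrite (funext (uE m k)); exact: measurable_funeM.
have u0 m k o : setT o -> 0 <= u m k o.
  by move=> _; rewrite /u; case: ifP => // _; rewrite lee_fin ltW.
pose I (m : nat) := \int[P]_o (\sum_(0 <= k <oo) u m k o).
have IE m : I m = \sum_(0 <= k <oo)
    (m.+1%:R^-1)%:E * (1 - outer P [set o | h o < (m.+1%:R^-1 * k%:R)%:E]).
  rewrite /I (integral_nneseries _ _ (mu m) (u0 m))//.
  apply: eq_eseriesr => k _; under eq_integral do rewrite uE.
  rewrite (ge0_integralZl_EFin _ _ _ (mind m k))//.
  congr (_ * _); rewrite integral_indic// setIT (outer_version _ mh' mN N0 e).
  rewrite -probability_setC; last first.
    by rewrite -[X in measurable X]setTI; exact: emeasurable_fun_infty_o.
  by congr (P _); apply/seteqP; split=> o /=; rewrite /A/= leNgt => /negP.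
have mI m : measurable_fun setT (fun o : O => \sum_(0 <= k <oo) u m k o : \bar R).
  by apply: ge0_emeasurable_sum => [k o ? _|k _]; [exact: u0|exact: mu].
rewrite -(funext IE).
apply/eqP; rewrite eq_le; apply/andP; split.
  apply: le_ereal_inf_tmp => _ [m _ <-]; apply: ge0_le_integral => // o _.
  exact: le_riemann.
apply/lee_addgt0Pr => c /ex_invS_lt[m mc].
apply: (@le_trans _ _ (I m)); first by apply: ereal_inf_lbound; exists m.
apply: (@le_trans _ _ (\int[P]_o (h' o + (m.+1%:R^-1)%:E))).
  apply: ge0_le_integral => //.
  - by move=> o _; apply: nneseries_ge0 => k _ _; exact: u0.
  - exact: emeasurable_funD.
  - by move=> o _; exact: riemann_le.
rewrite ge0_integralD// leeD2l// integral_cst//.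
rewrite [X in _ * X](_ : _ = 1); last exact: probability_setT.
by rewrite mule1 lee_fin ltW.
Qed.

Lemma lsa_section (T : Type) (M : set (set T)) (N : set (set Omega))
    (H : T * Omega -> \bar R) x : sigma_algebra setT N ->
  lsa (prod_sigma M N) H -> lsa N (fun o => H (x, o)).
Proof.
move=> sN lH; apply: (lsa_comp (g := fun o => (x, o)) _ lH).
apply: (prod_sigma_preimage (g := fun=> x) (h := id)) => // A MA.
have [Ax|nAx] := pselect (A x).
  rewrite (_ : _ @^-1` _ = setT); first exact: salg_setT.
  by apply/seteqP; split.
rewrite (_ : _ @^-1` _ = set0); first by case: sN.
by apply/seteqP; split.
Qed.

(** [expect_riemann] reduces the claim to functions d(1 - outer measure) with d = 1/(m+1). Such a
    function is below [c] exactly when the outer measure exceeds 1 - c/d, which is the strict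
    inequality handled by [suslin_section]. *)
Lemma lsa_expect (T : Type) (M : set (set T)) (H : T * Omega -> \bar R) :
  sigma_algebra setT M -> (forall z, 0 <= H z) ->
  lsa (prod_sigma M (@borel Omega)) H ->
  lsa M (fun x => expect P (fun o => H (x, o))).
Proof.
move=> sM H0 lH.
rewrite (_ : (fun=> _) = fun x => ereal_inf (range (fun m : nat => \sum_(0 <= k <oo)
    (m.+1%:R^-1)%:E * (1 - outer P [set o | H (x, o) < (m.+1%:R^-1 * k%:R)%:E])))).
  apply: lsa_inf => // m; have m0 : (0 < m.+1%:R^-1 :> R)%R by rewrite invr_gt0.
  have fP : P setT < +oo by rewrite probability_setT ltry.
  apply: lsa_series => // [k x|k c].
    apply: mule_ge0; first by rewrite lee_fin ltW.
    rewrite sube_ge0 ?outer_fin_num//.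
    by rewrite (le_trans (outer_le P measurableT _))// -(probability_setT P).
  rewrite (_ : [set _ | _] = [set x | (1 - m.+1%:R * c)%:E <
      outer P [set o | [set z | H z < (m.+1%:R^-1 * k%:R)%:E] (x, o)]]).
    by apply: suslin_section => //; exact: lH.
  apply/seteqP; split=> x /=; rewrite -(fineK (outer_fin_num fP _)) -EFinB -EFinM;
    rewrite !lte_fin ltr_pdivrMl// ltrBlDr -ltrBlDl//.
apply/funext => x; apply: expect_riemann => //.
by apply: lsa_section lH; exact: borel_sigma.
Qed.

End expect_lsa.

(** * Independence and approximate minimizers *)

(** Restrictions to a sub-sigma-algebra and laws on a product sigma-algebra are both images under an
    identity or diagonal map between different measurable structures. *)
Lemma ex_image_measure d1 d2 (T1 : measurableType d1) (T2 : measurableType d2)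
    (R : realType) (mu : {measure set T1 -> \bar R}) (f : T1 -> T2) :
  measurable_fun setT f ->
  exists2 nu : {measure set T2 -> \bar R}, forall A, nu A = mu (f @^-1` A) &
    forall h : T2 -> \bar R, measurable_fun setT h -> (forall y, 0 <= h y) ->
      \int[nu]_y h y = \int[mu]_x h (f x).
Proof.
move=> mf; pose nu : {measure set T2 -> \bar R} := pushforward mu f.
by exists (nu mf) => // h mh h0; rewrite ge0_integral_pushforward.
Qed.

Section sub_sigma.
Variables (R : realType) (Omega : ptopologicalType).
Variable P : probability (borelType Omega) R.
Local Notation O := (borelType Omega).

Let fP : P setT < +oo. Proof. by rewrite probability_setT ltry. Qed.

(* By independence, the law of [(o, o)] on the product of [H1] and [H2] is the
   product of the restrictions of [P]; then Tonelli applies. *)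
Lemma expect_indep (H1 H2 : set (set Omega)) (h : Omega * Omega -> \bar R) :
  sigma_algebra setT H1 -> sigma_algebra setT H2 ->
  H1 `<=` @borel Omega -> H2 `<=` @borel Omega ->
  (forall E1 E2, H1 E1 -> H2 E2 -> P (E1 `&` E2) = P E1 * P E2) ->
  (forall z, 0 <= h z) -> lsa (prod_sigma H1 H2) h ->
  expect P (fun o => h (o, o)) = expect P (fun o => expect P (fun o' => h (o, o'))).
Proof.
move=> s1 s2 sub1 sub2 ind h0 lh.
pose G := [set A `*` B | A in H1 & B in H2].
pose S := g_sigma_algebraType (G : set (set (Omega * Omega)%type)).
have mdiag : measurable_fun setT (fun o : O => (o, o) : S).
  move=> _ B mB; rewrite setTI.
  apply: (prod_sigma_preimage (M := H1) (N := H2) (g := id) (h := id)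
    (O := @borel Omega)) mB => //.
  exact: borel_sigma.
have mid : measurable_fun setT (fun z : O * O => z : S).
  move=> _ B mB; rewrite setTI.
  suff : @measurable _ (O * O)%type B by [].
  rewrite measurable_prod_measurableType.
  by apply: sub_sigma_algebra2 mB => _ [A HA [C HC <-]]; exists A => //;
    [exact: sub1|exists C => //; exact: sub2].
have [nu1 nu1E int1] := ex_image_measure P mdiag.
have [nu2 nu2E int2] := ex_image_measure (P \x P) mid.
have nuE B : measurable B -> nu1 B = nu2 B.
  apply: (@measure_unique _ _ S G (fun=> setT)) => //.
  - move=> _ _ [A HA [B1 HB <-]] [C HC [D HD <-]].
    exists (A `&` C); first exact: (salg_interclosed s1).2.
    by exists (B1 `&` D); [exact: (salg_interclosed s2).2|rewrite setXI].
  - by move=> _; exists setT; [exact: salg_setT|exists setT; [exact: salg_setT|rewrite setXTT]].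
  - by rewrite bigcup_const//; exists 0%N.
  - move=> _ [A HA [C HC <-]].
    rewrite nu1E nu2E preimage_id.
    transitivity (P A * P C).
      rewrite -ind//; congr (P _); apply/seteqP; split=> o //=.
    by rewrite -product_measure1E//; [exact: sub1|exact: sub2].
  - by move=> _; rewrite nu1E preimage_setT; exact: fP.
have fnu : nu1 setT < +oo.
  by rewrite nu1E preimage_setT; exact: fP.
have [h' [N [mh' h'0 mN N0 hh']]] := lsa_measurable_version fnu h0 lh.
have mh2 : measurable_fun setT (h' : O * O -> \bar R) by exact: measurableT_comp mh' mid.
have mN2 : measurable (N : set (O * O)) by rewrite -[X in measurable X]setTI; exact: (mid measurableT N mN).
have mNd : measurable ([set o | N (o, o)] : set O).
  by have := mdiag measurableT N mN; rewrite setTI; exact.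
have mhd : measurable_fun setT (fun o : O => h' (o, o)).
  exact: (measurableT_comp mh' mdiag).
have Nd0 : P [set o | N (o, o)] = 0 by rewrite -N0 nu1E.
rewrite (expectE (h := fun o => h (o, o)) _ mhd _ mNd Nd0)//; last first.
  by move=> o No; exact: hh'.
transitivity (\int[P]_o \int[P]_o' h' (o, o')).
  rewrite -(int1 h')// (eq_measure_integral nu2); last by move=> B mB _; exact: nuE.
  rewrite int2//; exact: fubini_tonelli1.
apply/esym.
(* Almost every section of the exceptional set [N] is null. On the null set [Z] of the other [o] the
   inner expectation is not computed, which the outer one does not notice. *)
have PN : \int[P]_o P (xsection (N : set (O * O)) o) = 0.
  by rewrite -[RHS]N0 nuE// nu2E preimage_id.
have mPN : measurable_fun setT (P \o xsection (N : set (O * O))).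
  exact: measurable_fun_xsection.
pose Z := [set o | P (xsection (N : set (O * O)) o) != 0].
have mZ : measurable (Z : set O).
  by rewrite -[X in measurable X]setTI; exact: emeasurable_neq.
apply: (@expectE _ _ P _ _ Z) => //.
- by move=> o; exact: expect_ge0.
- exact: measurable_fun_fubini_tonelli_F.
- by move=> o; exact: integral_ge0.
- have /(ae_eq_integral_abs P measurableT mPN) [Y [mY Y0 ZY]] :
      \int[P]_o `|P (xsection (N : set (O * O)) o)| = 0.
    by rewrite -[RHS]PN; apply: eq_integral => o _; rewrite gee0_abs.
  apply/negligibleP => //; exists Y; split=> // o Zo; apply: ZY => /= /(_ I) e.
  by move/eqP: Zo; exact.
- move=> o nZ.
  apply: (@expectE _ _ P _ _ (xsection (N : set (O * O)) o)) => //.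
  + exact: measurableT_comp mh2 (pair1_measurable _).
  + exact: measurable_xsection.
  + by apply/eqP; apply: contrapT => /negP.
  + by move=> o' No; apply: hh' => No'; apply: No; rewrite /xsection /= inE.
Qed.

(** The restriction of [P] to [E2] and the multiple of [P] by [P E2] are finite measures agreeing on
    a pi-system containing the whole space, hence on the sigma-algebra it generates. *)
Lemma indep_sigma (G : set (set Omega)) (E2 : set Omega) : setI_closed G ->
  G setT -> G `<=` @borel Omega -> borel E2 ->
  (forall E1, G E1 -> P (E1 `&` E2) = P E1 * P E2) ->
  forall E1, <<s G >> E1 -> P (E1 `&` E2) = P E1 * P E2.
Proof.
move=> GI GT subG bE2 ind E1 GE1.
have mE2 : measurable (E2 : set O) by [].
have PE2 : 0 <= P E2 by [].
pose m1 := mrestr P mE2.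
have fE2 : P E2 \is a fin_num by exact: fin_num_measure.
pose r := NngNum (fine_ge0 PE2).
pose m2 := mscale r P.
have := @g_sigma_algebra_measure_unique _ R O G subG (fun=> setT) _ _ m1 m2.
move=> /(_ (fun=> GT)) H.
have m2E A : m2 A = P A * P E2.
  by rewrite muleC; congr (_ * _); exact: fineK.
rewrite -m2E.
apply: H => //.
- by rewrite bigcup_const//; exists 0%N.
- by move=> A GA; exact: etrans (ind A GA) (esym (m2E A)).
- by move=> _; rewrite /m1/= /mrestr setTI -ge0_fin_numE.
Qed.

(** Selection takes place on [Omega] endowed with [H] and the restriction of [P], so that [phi] is
    measurable for [H] and not only for the Borel field or the completion. *)
Lemma approx_selection (H : set (set Omega)) (U : topologicalType)
    (p : (nat -> nat) -> U) (g : Omega * U -> \bar R) (e : R) :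
  sigma_algebra setT H -> H `<=` @borel Omega ->
  (forall u, exists y, p y = u) ->
  (forall B, borel B -> baire_sigma (p @^-1` B)) ->
  (forall z, 0 <= g z) -> lsa (prod_sigma H (@borel U)) g -> (0 < e)%R ->
  exists (phi : Omega -> U) (Z : set Omega),
    [/\ forall B, borel B -> H (phi @^-1` B), borel Z, P Z = 0 &
      forall o, ~ Z o ->
        g (o, phi o) <= ereal_inf (range (fun u => g (o, u))) + e%:E].
Proof.
move=> sH subH surj mp g0 lg e0.
pose S := g_sigma_algebraType (H : set (set Omega)).
have SH : @measurable _ S = H by exact: measurable_g_measurableTypeE.
have mid : measurable_fun setT (fun o : O => o : S).
  by move=> _ B mB; rewrite setTI; apply: subH; rewrite -SH.
have [nu nuE _] := ex_image_measure P mid.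
pose v o := ereal_inf (range (fun u => g (o, u))).
have v0 o : 0 <= v o by apply: le_ereal_inf_tmp => _ [u _ <-].
have fnu : nu setT < +oo by rewrite nuE preimage_setT; exact: fP.
have lv : lsa (@measurable _ S) v by rewrite SH; exact: (lsa_infU sH surj mp lg).
have [v' [N [mv' v'0 mN N0 vv']]] := lsa_measurable_version fnu v0 lv.
pose q n : R := if @unpickle rat n is Some r then ratr r else 0%R.
(* The infimum [v] has Souslin sublevel sets, so the sets where it exceeds a rational need not be
   Souslin; with the [H]-measurable version [v'] in its place, a rational cut makes the e-optimality
   constraint Souslin. *)
pose A := \bigcup_n ([set z | g z < (q n)%:E] `&`
  ([set o | (q n)%:E < v' o + e%:E] `*` setT)).
have mA : suslin (prod_sigma (@measurable _ S) (@borel U)) A.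
  have sp := prod_sigma_algebra (@measurable _ S) (@borel U).
  have ip := salg_interclosed sp.
  apply: suslin_bigcup => // n; apply: (suslin_interclosed ip).2.
    by rewrite SH; exact: lg.
  apply: sub_suslin; apply: prod_sigma_rect; last exact: salg_setT (@borel_sigma U).
  rewrite -[X in measurable X]setTI; apply: emeasurable_fun_o_infty => //.
  by apply: emeasurable_funD.
have [phi [Z [mphi mZ Z0 phiA]]] := suslin_selection fnu surj mp mA.
rewrite SH in mphi mZ mN.
exists phi, (Z `|` N); split=> //.
- by apply: subH; exact: (salg_setU sH).
- apply/negligibleP.
    by apply: (salg_setU (@borel_sigma Omega)); exact: subH.
  have PZ : P Z = 0 by rewrite -Z0 nuE.
  have PN : P N = 0 by rewrite -N0 nuE.
  by apply: negligibleU; apply/negligibleP => //; [exact: subH mZ|exact: subH mN].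
- move=> o /not_orP[nZ nN]; rewrite -/(v o).
  have := v0 o; case ev : (v o) => [r| |]// _; last by rewrite addye// leey.
  suff [n _ [/= gn [/= qn _]]] : A (o, phi o).
    by rewrite -ev vv'// ltW// (lt_trans gn).
  apply: phiA => //.
  have [|_ [u _ <-] gu] := @lb_ereal_inf_adherent _ (range (fun u => g (o, u))) e e0.
    by rewrite -/(v o) ev.
  have gu' : g (o, u) < (r + e)%:E by move: gu; rewrite -/(v o) ev.
  exists u.
  have := g0 (o, u); move: gu'; case eg : (g (o, u)) => [s| |]//; rewrite lte_fin => sr _.
  have [a] := rat_in_itvoo sr; rewrite in_itv /= => /andP[sa ar].
  exists (pickle a) => //; rewrite /q pickleK; split; rewrite /= ?eg ?lte_fin//.
  by split=> //=; rewrite -vv'// ev -EFinD lte_fin.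
Qed.

End sub_sigma.

(** * The sigma-fields of the past and their independence from the next noise *)

Section history_theory.
Variables (R : realType) (T : nat) (W : nat -> topologicalType).
Variables (X0 : topologicalType) (Omega : ptopologicalType).
Variable P : probability (borelType Omega) R.
Variables (x0 : Omega -> X0) (w : forall t, Omega -> W t).
Hypothesis x0_meas : borel_measurable x0.
Hypothesis w_meas : forall t, (1 <= t <= T)%N -> borel_measurable (@w t).

Lemma history_sigma t : sigma_algebra setT (history x0 w t).
Proof. exact: smallest_sigma_algebra. Qed.

Lemma history_borel t : (t <= T)%N -> history x0 w t `<=` @borel Omega.
Proof.
move=> tT; apply: smallest_sub => [|E]; first exact: borel_sigma.
move=> [|[s /= /andP[s1 st]]] [B bB <-]; rewrite setTI; first exact: x0_meas.
by apply: w_meas => //; rewrite s1 (leq_trans st).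
Qed.

Lemma le_history s t : (s <= t)%N -> history x0 w s `<=` history x0 w t.
Proof.
move=> st; apply: sub_sigma_algebra2 => E [|[r /= /andP[r1 rs]] Er]; first by left.
by right; exists r => //=; rewrite r1 (leq_trans rs).
Qed.

Lemma history_noise t B : borel B -> history x0 w t.+1 (@w t.+1 @^-1` B).
Proof.
move=> bB; apply: sub_sigma_algebra; right; exists t.+1 => /=; first by rewrite leqnn.
by exists B => //; rewrite setTI.
Qed.

(** A deterministic initial state generates the trivial sigma-field, so finite intersections of
    noise events form a pi-system whose sigma-algebra contains the history. *)
Lemma history_indep (a : X0) (t : nat) : (forall o, x0 o = a) ->
  mutually_independent P (fun i : 'I_T => @w i.+1) -> (t < T)%N ->
  forall E1 B, history x0 w t E1 -> borel B ->
    P (E1 `&` @w t.+1 @^-1` B) = P E1 * P (@w t.+1 @^-1` B).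
Proof.
move=> x0a ind tT E1 B hE1 bB.
have wmeas (i : 'I_T) (A : set (W i.+1)) : borel A -> borel (@w i.+1 @^-1` A).
  by apply: w_meas; rewrite /= ltn_ord.
(* Index [i] stands for W_(i+1), so [i < t] selects W_1, ..., W_t, and the index [t] is the next
   noise. *)
pose J : {set 'I_T} := [set i : 'I_T | (i < t)%N]%SET.
pose G : set (set Omega) := [set E | exists2 A : forall i : 'I_T, set (W i.+1),
  (forall i, borel (A i)) & E = \bigcap_(i in [set` J]) (@w i.+1 @^-1` A i)].
have bT i : borel [set: W i] by exact: salg_setT (@borel_sigma _).
have GT : G setT by exists (fun=> setT) => //; apply/seteqP; split.
have hG : history x0 w t `<=` <<s G >>.
  apply: smallest_sub => [|E]; first exact: smallest_sigma_algebra.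
  have sG := smallest_sigma_algebra setT G.
  move=> [[C bC <-]|[s /= /andP[s1 st] [C bC <-]]]; rewrite setTI.
    have [Ca|Ca] := pselect (C a).
      rewrite (_ : _ @^-1` _ = setT); first exact: salg_setT.
      by apply/seteqP; split=> // o _; rewrite /= x0a.
    rewrite (_ : _ @^-1` _ = set0); first by case: sG.
    by apply/seteqP; split=> // o; rewrite /= x0a.
  case: s s1 st C bC => // s _ st C bC; apply: sub_sigma_algebra.
  pose i : 'I_T := Ordinal (leq_trans st (ltnW tT)).
  exists (@eqtype.dfwith 'I_T (fun i => set (W i.+1)) (fun=> setT) i C).
    move=> j; have [->|ij] := eqVneq j i; first by rewrite eqtype.dfwith_in.
    by rewrite eqtype.dfwith_out// eq_sym.
  apply/seteqP; split=> o /=.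
    move=> Co j _; have [->|ij] := eqVneq j i; first by rewrite eqtype.dfwith_in.
    by rewrite eqtype.dfwith_out// eq_sym.
  by move=> /(_ i); rewrite eqtype.dfwith_in; apply; rewrite /= inE.
apply: (@indep_sigma _ _ P G) => //; last exact: hG.
- move=> _ _ [A1 bA1 ->] [A2 bA2 ->]; exists (fun i => A1 i `&` A2 i).
    by move=> i; apply: (salg_interclosed (@borel_sigma _)).2.
  by rewrite -bigcapI.
- move=> _ [A bA ->].
  apply: (@fin_bigcap_measurable _ (borelType Omega)); first exact: finite_finset.
  by move=> i _; exact: wmeas.
- by apply: w_meas.
move=> _ [A bA ->].
pose i0 : 'I_T := Ordinal tT.
(* Mutual independence is used for [J] and for [J] with the next index added; [A'] puts [B] at that
   index and changes nothing on [J]. *)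
pose A' := @eqtype.dfwith 'I_T (fun i => set (W i.+1)) A i0 B.
have A'in : A' i0 = B by rewrite /A' eqtype.dfwith_in.
have A'out i : i \in J -> A' i = A i.
  by rewrite inE => it; rewrite /A' eqtype.dfwith_out// -val_eqE /= gtn_eqF.
have bA' i : borel (A' i).
  have [->|ij] := eqVneq i i0; first by rewrite A'in.
  by rewrite /A' eqtype.dfwith_out// eq_sym.
have i0J : i0 \notin J by rewrite inE ltnn.
have := ind (i0 |: J)%SET A' bA'; rewrite big_setU1//= A'in.
rewrite (eq_bigr (fun i : 'I_T => P (@w i.+1 @^-1` A i))); last first.
  by move=> i iJ; rewrite A'out.
rewrite -ind// => e; rewrite muleC -e; congr (P _).
apply/seteqP; split=> o.
  move=> [Ao Bo] i /=; rewrite !inE => /orP[/eqP->|]; first by rewrite A'in.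
  by move=> it; rewrite A'out ?inE//; apply: Ao; rewrite /= inE.
move=> A'o; split; last first.
  by have := A'o i0; rewrite A'in; apply; rewrite /= setU11.
move=> i /= iJ; have := A'o i; rewrite A'out//; apply.
by rewrite /= setU1r.
Qed.

End history_theory.

(** * One step of the dynamic programming recursion *)

Definition measurable_wrt (E : Type) (M : set (set E)) (Y : topologicalType)
    (g : E -> Y) : Prop := forall B, borel B -> M (g @^-1` B).

Lemma measurable_wrt_pair (E : Type) (M : set (set E)) (Y Z : topologicalType)
    (g : E -> Y) (h : E -> Z) : sigma_algebra setT M ->
  countable_base Y -> countable_base Z ->
  measurable_wrt M g -> measurable_wrt M h -> measurable_wrt M (fun e => (g e, h e)).
Proof.
move=> sM bY bZ mg mh B /(borel_prod bY bZ).
exact: (prod_sigma_preimage sM mg mh).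
Qed.

Section one_step.
Variables (R : realType) (X U W V : topologicalType) (Omega : ptopologicalType).
Variable P : probability (borelType Omega) R.
Hypotheses (bX : borel_space R X) (bU : borel_space R U).
Hypotheses (bW : borel_space R W) (bV : borel_space R V).
Variables (w : Omega -> W) (J : X * U * W * V -> \bar R).
Hypothesis w_meas : borel_measurable w.
Hypotheses (J0 : forall z, 0 <= J z) (lJ : lsa (@borel _) J).

Definition step_flat (y : X * U * W) : \bar R := ereal_inf (range (fun v => J (y, v))).
Definition step_mean (y : X * U) : \bar R := expect P (fun o => step_flat (y, w o)).
Definition step_value (x : X) : \bar R := ereal_inf (range (fun u => step_mean (x, u))).

Let cX := borel_space_countable_base bX.
Let cU := borel_space_countable_base bU.
Let cW := borel_space_countable_base bW.
Let cV := borel_space_countable_base bV.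
Let cXU := countable_base_prod cX cU.
Let cXUW := countable_base_prod cXU cW.

Let lsa_infU_borel (Y Z : topologicalType) (h : Y * Z -> \bar R) :
  borel_space R Z -> lsa (prod_sigma (@borel Y) (@borel Z)) h ->
  lsa (@borel Y) (fun y => ereal_inf (range (fun z => h (y, z)))).
Proof.
move=> bZ lh; have [[z0]|nZ] := pselect (inhabited Z).
  have [p [sp mp]] := borel_space_surjection bZ z0.
  exact: (lsa_infU (@borel_sigma Y) sp mp lh).
(* Baire space has no map to an empty space, but there the infimum is constantly [+oo]. *)
rewrite (_ : (fun=> _) = fun=> +oo); first by apply: lsa_cst; exact: borel_sigma.
apply/funext => y; have -> : range (fun z => h (y, z)) = set0.
  by apply/seteqP; split=> // t [z]; exfalso; apply: nZ; exists.
exact: ereal_inf0.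
Qed.

Lemma step_flat_ge0 y : 0 <= step_flat y.
Proof. by apply: le_ereal_inf_tmp => _ [v _ <-]. Qed.

Lemma step_mean_ge0 y : 0 <= step_mean y.
Proof. by apply: expect_ge0 => o; exact: step_flat_ge0. Qed.

Lemma step_value_ge0 x : 0 <= step_value x.
Proof. by apply: le_ereal_inf_tmp => _ [u _ <-]; exact: step_mean_ge0. Qed.

Let lJ' : lsa (prod_sigma (@borel (X * U * W)%type) (@borel V)) J.
Proof. by move=> c; apply: suslin_sub (lJ c); exact: borel_prod. Qed.

Lemma step_flat_lsa : lsa (@borel _) step_flat.
Proof. exact: lsa_infU_borel. Qed.

Lemma step_mean_lsa : lsa (@borel _) step_mean.
Proof.
apply: (lsa_expect P (H := fun z => step_flat (z.1, w z.2))).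
- exact: borel_sigma.
- by move=> z; exact: step_flat_ge0.
- apply: (lsa_comp (g := fun z => (z.1, w z.2)) _ step_flat_lsa).
  have sp := prod_sigma_algebra (@borel (X * U)%type) (@borel Omega).
  apply: (measurable_wrt_pair sp cXU cW) => B bB.
    rewrite (_ : _ @^-1` _ = B `*` setT); last by apply/seteqP; split=> // z [].
    by apply: prod_sigma_rect => //; exact: salg_setT (@borel_sigma _).
  rewrite (_ : _ @^-1` _ = setT `*` (w @^-1` B)); last by apply/seteqP; split=> // z [].
  by apply: prod_sigma_rect; [exact: salg_setT (@borel_sigma _)|exact: w_meas].
Qed.

Lemma step_value_lsa : lsa (@borel _) step_value.
Proof.
apply: lsa_infU_borel => // c.
by apply: suslin_sub (step_mean_lsa c); exact: borel_prod.
Qed.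

(* [H0] and [H1] stand for the information before and after the noise [w]. *)
Variables (H0 H1 : set (set Omega)).
Hypotheses (sH0 : sigma_algebra setT H0) (sH1 : sigma_algebra setT H1).
Hypotheses (H01 : H0 `<=` H1) (H1b : H1 `<=` @borel Omega).
Hypothesis H1w : measurable_wrt H1 w.
Hypothesis indw : forall E B, H0 E -> borel B ->
  P (E `&` w @^-1` B) = P E * P (w @^-1` B).

Section fixed_state.
Variables (y : Omega -> X) (S : Omega -> \bar R).
Hypotheses (my : measurable_wrt H0 y).
Hypotheses (S0 : forall o, 0 <= S o) (lS : lsa (@borel Omega) S).

Let H0b : H0 `<=` @borel Omega := subset_trans H01 H1b.

Section fixed_decision.
Variable u : Omega -> U.
Hypothesis mu : measurable_wrt H0 u.

Let myu : measurable_wrt H0 (fun o => (y o, u o)).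
Proof. exact: measurable_wrt_pair. Qed.

Let myuw : measurable_wrt H1 (fun o => (y o, u o, w o)).
Proof. by apply: measurable_wrt_pair => // B bB; apply: H01; exact: myu. Qed.

Let lmean : lsa (@borel Omega) (fun o => step_mean (y o, u o)).
Proof.
apply: (lsa_comp (g := fun o => (y o, u o)) _ step_mean_lsa) => B bB.
by apply: H0b; exact: myu.
Qed.

Let lflat : lsa (@borel Omega) (fun o => step_flat (y o, u o, w o)).
Proof.
apply: (lsa_comp (g := fun o => (y o, u o, w o)) _ step_flat_lsa) => B bB.
by apply: H1b; exact: myuw.
Qed.

Let lvalue : lsa (@borel Omega) (fun o => step_value (y o)).
Proof. by apply: (lsa_comp (g := y) _ step_value_lsa) => B bB; apply: H0b; exact: my. Qed.

(** The past cost [S] splits off by additivity on nonnegative functions, so independence is applied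
    to the last stage alone: state and decision are known to [H0], and the noise is independent of
    it. *)
Lemma expect_step_mean : expect P (fun o => S o + step_mean (y o, u o)) =
  expect P (fun o => S o + step_flat (y o, u o, w o)).
Proof.
have f0 o : 0 <= step_flat (y o, u o, w o) by exact: step_flat_ge0.
have m0 o : 0 <= step_mean (y o, u o) by exact: step_mean_ge0.
rewrite (expectD P S0 m0 lS lmean) (expectD P S0 f0 lS lflat).
congr (_ + _); apply/esym.
have sw : sigma_algebra setT (sigma_of w).
  exact/sigma_algebra_preimage/borel_sigma.
apply: (@expect_indep _ _ P H0 (sigma_of w) (fun z => step_flat (y z.1, u z.1, w z.2))) => //.
- by move=> _ [B bB <-]; rewrite setTI; exact: w_meas.
- by move=> E _ HE [B bB <-]; rewrite setTI; exact: indw.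
- by move=> z; exact: step_flat_ge0.
apply: (lsa_comp (g := fun z => (y z.1, u z.1, w z.2)) _ step_flat_lsa).
have sp := prod_sigma_algebra H0 (sigma_of w).
apply: (measurable_wrt_pair sp cXU cW) => B bB.
  rewrite (_ : _ @^-1` _ = ((fun o => (y o, u o)) @^-1` B) `*` setT).
    by apply: prod_sigma_rect; [exact: myu|exact: salg_setT].
  by apply/seteqP; split=> // z [].
rewrite (_ : _ @^-1` _ = setT `*` (w @^-1` B)); last by apply/seteqP; split=> // z [].
apply: prod_sigma_rect; first exact: salg_setT.
by exists B => //; rewrite setTI.
Qed.

Lemma lsa_step_cost (v : Omega -> V) : measurable_wrt H1 v ->
  lsa (@borel Omega) (fun o => J (y o, u o, w o, v o)).
Proof.
move=> mv; apply: (lsa_comp (g := fun o => (y o, u o, w o, v o)) _ lJ) => B bB.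
by apply: H1b; apply: (measurable_wrt_pair sH1 cXUW cV myuw mv).
Qed.

(** The value is at most the mean at [u o], and the inner infimum at most the cost at [v o]. These
    pointwise bounds are joined by [expect_step_mean], which holds only between expectations. *)
Lemma step_lower (v : Omega -> V) : measurable_wrt H1 v ->
  expect P (fun o => S o + step_value (y o)) <=
  expect P (fun o => S o + J (y o, u o, w o, v o)).
Proof.
move=> mv; have mJ := lsa_step_cost mv.
have b := @borel_sigma Omega.
apply: (@le_trans _ _ (expect P (fun o => S o + step_mean (y o, u o)))).
  apply: (@le_expect _ _ P _ _ set0) => //.
  - by move=> o; rewrite adde_ge0// step_value_ge0.
  - by move=> o; rewrite adde_ge0// step_mean_ge0.
  - by apply: lsa_add => // o; exact: step_value_ge0.
  - by apply: lsa_add => // o; exact: step_mean_ge0.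
  - by move=> o _; rewrite leeD2l//; apply: ereal_inf_lbound; exists (u o).
rewrite expect_step_mean; apply: (@le_expect _ _ P _ _ set0) => //.
- by move=> o; rewrite adde_ge0// step_flat_ge0.
- by move=> o; rewrite adde_ge0.
- by apply: lsa_add => // o; exact: step_flat_ge0.
- exact: lsa_add.
- by move=> o _; rewrite leeD2l//; apply: ereal_inf_lbound; exists (v o).
Qed.

(** The second decision sees the noise, so it is selected on [H1] with [w o] as part of the
    parameter, whereas the first one will be selected on [H0] from the averaged cost. *)
Lemma step_upper_flat (v0 : V) (e : R) : (0 < e)%R ->
  exists2 v : Omega -> V, measurable_wrt H1 v &
    expect P (fun o => S o + J (y o, u o, w o, v o)) <=
    expect P (fun o => S o + step_mean (y o, u o)) + e%:E.
Proof.
move=> e0; have [p [sp mp]] := borel_space_surjection bV v0.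
have [||v [Z [mv bZ Z0 hv]]] := @approx_selection _ _ P H1 V p
    (fun z => J (y z.1, u z.1, w z.1, z.2)) e sH1 H1b sp mp _ _ e0; first by [].
  have spr := prod_sigma_algebra H1 (@borel V).
  apply: (lsa_comp (g := fun z => (y z.1, u z.1, w z.1, z.2)) _ lJ).
  apply: (measurable_wrt_pair spr cXUW cV) => B bB.
    rewrite (_ : _ @^-1` _ = ((fun o => (y o, u o, w o)) @^-1` B) `*` setT).
      by apply: prod_sigma_rect; [exact: myuw|exact: salg_setT (@borel_sigma _)].
    by apply/seteqP; split=> // z [].
  rewrite (_ : _ @^-1` _ = setT `*` B); last by apply/seteqP; split=> // z [].
  by apply: prod_sigma_rect => //; exact: salg_setT.
exists v => //; have mJ := lsa_step_cost mv; have b := @borel_sigma Omega.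
rewrite expect_step_mean -(@expect_cst _ _ P e%:E)//; last by rewrite lee_fin ltW.
have lc : lsa (@borel Omega) (fun=> e%:E) by exact: lsa_cst.
have lSf : lsa (@borel Omega) (fun o => S o + step_flat (y o, u o, w o)).
  by apply: lsa_add => // o; exact: step_flat_ge0.
have Sf0 o : 0 <= S o + step_flat (y o, u o, w o) by rewrite adde_ge0// step_flat_ge0.
rewrite -expectD//; last by move=> o; rewrite lee_fin ltW.
apply: (@le_expect _ _ P _ _ Z) => //.
- by move=> o; rewrite adde_ge0.
- by move=> o; rewrite adde_ge0// lee_fin ltW.
- exact: lsa_add.
- by apply: lsa_add => // o; rewrite lee_fin ltW.
- by move=> o nZ; rewrite -addeA leeD2l//; exact: hv.
Qed.

End fixed_decision.

Lemma step_upper_natural (u0 : U) (e : R) : (0 < e)%R ->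
  exists2 u : Omega -> U, measurable_wrt H0 u &
    expect P (fun o => S o + step_mean (y o, u o)) <=
    expect P (fun o => S o + step_value (y o)) + e%:E.
Proof.
move=> e0; have [p [sp mp]] := borel_space_surjection bU u0.
have [||u [Z [mu bZ Z0 hu]]] := @approx_selection _ _ P H0 U p
    (fun z => step_mean (y z.1, z.2)) e sH0 H0b sp mp _ _ e0.
- by move=> z; exact: step_mean_ge0.
- have spr := prod_sigma_algebra H0 (@borel U).
  apply: (lsa_comp (g := fun z => (y z.1, z.2)) _ step_mean_lsa).
  apply: (measurable_wrt_pair spr cX cU) => B bB.
    rewrite (_ : _ @^-1` _ = (y @^-1` B) `*` setT).
      by apply: prod_sigma_rect; [exact: my|exact: salg_setT (@borel_sigma _)].
    by apply/seteqP; split=> // z [].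
  rewrite (_ : _ @^-1` _ = setT `*` B); last by apply/seteqP; split=> // z [].
  by apply: prod_sigma_rect => //; exact: salg_setT.
exists u => //; have b := @borel_sigma Omega.
have lm : lsa (@borel Omega) (fun o => step_mean (y o, u o)).
  apply: (lsa_comp (g := fun o => (y o, u o)) _ step_mean_lsa) => B bB.
  by apply: H0b; exact: (measurable_wrt_pair sH0 cX cU my mu).
have lv : lsa (@borel Omega) (fun o => step_value (y o)).
  by apply: (lsa_comp (g := y) _ step_value_lsa) => B bB; apply: H0b; exact: my.
rewrite -(@expect_cst _ _ P e%:E)//; last by rewrite lee_fin ltW.
have lc : lsa (@borel Omega) (fun=> e%:E) by exact: lsa_cst.
have lSf : lsa (@borel Omega) (fun o => S o + step_value (y o)).
  by apply: lsa_add => // o; exact: step_value_ge0.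
have Sf0 o : 0 <= S o + step_value (y o) by rewrite adde_ge0// step_value_ge0.
rewrite -expectD//; last by move=> o; rewrite lee_fin ltW.
apply: (@le_expect _ _ P _ _ Z) => //.
- by move=> o; rewrite adde_ge0// step_mean_ge0.
- by move=> o; rewrite adde_ge0// lee_fin ltW.
- by apply: lsa_add => // o; exact: step_mean_ge0.
- by apply: lsa_add => // o; rewrite lee_fin ltW.
- by move=> o nZ; rewrite -addeA leeD2l//; exact: hu.
Qed.

Lemma step_upper (u0 : U) (v0 : V) (e : R) : (0 < e)%R ->
  exists (u : Omega -> U) (v : Omega -> V),
    [/\ measurable_wrt H0 u, measurable_wrt H1 v &
      expect P (fun o => S o + J (y o, u o, w o, v o)) <=
      expect P (fun o => S o + step_value (y o)) + e%:E].
Proof.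
move=> e0; have e20 : (0 < e / 2)%R by rewrite divr_gt0.
have [u mu hu] := step_upper_natural u0 e20.
have [v mv hv] := step_upper_flat mu v0 e20.
exists u, v; split=> //; apply: (le_trans hv).
by rewrite [e in leRHS]splitr EFinD addeA leeD2r.
Qed.

End fixed_state.
End one_step.

(** * Dynamic programming *)

(** Both values have type [E -> Y m], so ordinals differing only in their bound proofs can be
    exchanged without transport. *)
Lemma ord_irr (E : Type) (Y : nat -> topologicalType) n
    (g : forall i : 'I_n, E -> Y i) m (p q : (m < n)%N) :
  g (Ordinal p) = g (Ordinal q).
Proof. by rewrite (bool_irrelevance p q). Qed.

Lemma ord_widen_max n (Q : 'I_n.+1 -> Prop) :
  (forall j : 'I_n, Q (widen_ord (leqnSn n) j)) -> Q ord_max -> forall i, Q i.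
Proof.
move=> Qw Qm i; have [ilt|] := ltnP i n.
  have -> : i = widen_ord (leqnSn n) (Ordinal ilt) by exact: val_inj.
  exact: Qw.
move=> ni; have -> // : i = ord_max.
by apply: val_inj; apply/eqP; rewrite eqn_leq ni -ltnS ltn_ord.
Qed.

(** The value at [i] has a type depending on [i], so the new value is transported along the equality
    of [i] with [n]; uniqueness of identity proofs on [nat] removes the transport at [ord_max]. *)
Lemma ord_extend (D : nat -> Type) n (g : forall i : 'I_n, D i) (v : D n) :
  exists g' : forall i : 'I_n.+1, D i,
    (forall i, g' (widen_ord (leqnSn n) i) = g i) /\ g' ord_max = v.
Proof.
have lt (i : 'I_n.+1) : (i : nat) <> n -> (i < n)%N.
  by move=> /eqP ne; rewrite ltn_neqAle ne -ltnS ltn_ord.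
pose g' (i : 'I_n.+1) : D i := match @eqP _ (i : nat) n with
  | ReflectT e => eq_rect_r D v e
  | ReflectF ne => g (Ordinal (lt i ne)) end.
exists g'; split=> [[m mn]|]; rewrite /g'.
  case: eqP => [e|ne]; last first.
    exact: (congr1 (fun p : (m < n)%N => g (Ordinal p) : D m)
      (bool_irrelevance (lt _ ne) mn)).
  by exfalso; have : (m < n)%N := mn; have -> : m = n := e; rewrite ltnn.
by case: eqP => // e; rewrite (eq_irrelevance e erefl).
Qed.

Lemma sigma_ofP (E : Type) (M : set (set E)) (Y : topologicalType) (g : E -> Y) :
  sigma_of g `<=` M <-> measurable_wrt M g.
Proof.
split=> [sub B bB|mg _ [B bB <-]]; last by rewrite setTI; exact: mg.
by apply: sub; exists B => //; rewrite setTI.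
Qed.

Section dynamic_programming.
Unset Implicit Arguments.
Variables (R : realType) (T : nat) (Un Uf W X : nat -> topologicalType).
Hypothesis Un_borel : forall t, (t < T)%N -> borel_space R (Un t).
Hypothesis Uf_borel : forall t, (1 <= t <= T)%N -> borel_space R (Uf t).
Hypothesis W_borel : forall t, (1 <= t <= T)%N -> borel_space R (W t).
Hypothesis X_borel : forall t, (t <= T)%N -> borel_space R (X t).
Variable f : forall t : nat, X t * Un t * W t.+1 * Uf t.+1 -> X t.+1.
Hypothesis f_meas : forall t, (t < T)%N -> borel_measurable (f t).
Variable L : forall t : nat, X t * Un t * W t.+1 * Uf t.+1 -> \bar R.
Hypothesis L_ge0 : forall t, (t < T)%N -> forall z, 0 <= L t z.
Hypothesis L_lsa : forall t, (t < T)%N -> lower_semianalytic (L t).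
Variables (Omega : ptopologicalType) (P : probability (borelType Omega) R).
Variables (x0 : Omega -> X 0%N) (w : forall t : nat, Omega -> W t).
Hypothesis x0_meas : borel_measurable x0.
Hypothesis w_meas : forall t, (1 <= t <= T)%N -> borel_measurable (w t).
Variable a : X 0%N.
Hypothesis x0_deterministic : forall o, x0 o = a.
Hypothesis w_indep : mutually_independent P (fun t : 'I_T => w t.+1).
Variable V : forall t : nat, X t -> \bar R.
Hypothesis V_final_ge0 : forall z : X T, 0 <= V T z.
Hypothesis V_final_lsa : lower_semianalytic (V T).
Hypothesis V_backward : forall t, (t < T)%N -> forall x : X t,
  V t x = ereal_inf (range (fun un : Un t =>
    expect P (fun o => ereal_inf (range (fun uf : Uf t.+1 =>
      L t (x, un, w t.+1 o, uf) + V t.+1 (f t (x, un, w t.+1 o, uf))))))).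

Set Implicit Arguments.

Let J t (z : X t * Un t * W t.+1 * Uf t.+1) : \bar R := L t z + V t.+1 (f t z).

Let XSb t : (t < T)%N -> borel_space R (X t). Proof. by move/ltnW; exact: X_borel. Qed.

Let WSb t : (t < T)%N -> borel_space R (W t.+1).
Proof. by move=> tT; apply: W_borel; rewrite /= tT. Qed.

Let UfSb t : (t < T)%N -> borel_space R (Uf t.+1).
Proof. by move=> tT; apply: Uf_borel; rewrite /= tT. Qed.

Let wSm t : (t < T)%N -> borel_measurable (w t.+1).
Proof. by move=> tT; apply: w_meas; rewrite /= tT. Qed.

Let L_suslin t : (t < T)%N -> lsa (@borel _) (L t).
Proof.
move=> tT c; apply: analytic_suslin (L_lsa t tT c).
apply: hausdorff_prod; last exact: borel_space_hausdorff (UfSb tT).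
apply: hausdorff_prod; last exact: borel_space_hausdorff (WSb tT).
apply: hausdorff_prod; last exact: borel_space_hausdorff (Un_borel t tT).
exact: borel_space_hausdorff (XSb tT).
Qed.

Let J_lsa t : (t < T)%N -> (forall x, 0 <= V t.+1 x) -> lsa (@borel _) (V t.+1) ->
  (forall z, 0 <= @J t z) /\ lsa (@borel _) (@J t).
Proof.
move=> tT V0 lV; split=> [z|]; first by rewrite adde_ge0// L_ge0.
apply: lsa_add => //; first exact: borel_sigma.
- exact: L_ge0.
- exact: L_suslin.
- by apply: (lsa_comp (g := f t)) lV; exact: f_meas.
Qed.

Let V_step t : (t < T)%N -> V t = step_value P (w t.+1) (@J t).
Proof. by move=> tT; apply/funext => x; rewrite V_backward. Qed.

Let V_lsa t : (t <= T)%N -> (forall x, 0 <= V t x) /\ lsa (@borel _) (V t).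
Proof.
(* Downward induction from [T], on the number [T - t] of remaining steps. *)
move=> tT; rewrite -(subKn tT); move: (leq_subr t T).
elim: (T - t)%N => [|k IH] kT.
  rewrite subn0; split=> // c; apply: analytic_suslin (V_final_lsa c).
  exact: (borel_space_hausdorff (X_borel _ (leqnn T))).
have sT : (T - k.+1 < T)%N by rewrite ltn_subrL (leq_trans _ kT).
have e : (T - k.+1).+1 = (T - k)%N by rewrite subnSK.
have := IH (ltnW kT); rewrite -e => -[V0 lV].
have [J0 lJ] := J_lsa sT V0 lV; rewrite (V_step sT); split.
  by move=> x; exact: step_value_ge0.
by apply: step_value_lsa => //; [exact: XSb|exact: Un_borel|exact: WSb|exact: UfSb|exact: wSm].
Qed.

Lemma decision_measurable m (mT : (m < T)%N) (y : Omega -> X m)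
    (u : Omega -> Un m) (v : Omega -> Uf m.+1) :
  measurable_wrt (history x0 w m) y -> measurable_wrt (history x0 w m) u ->
  measurable_wrt (history x0 w m.+1) v ->
  measurable_wrt (history x0 w m.+1) (fun o => (y o, u o, w m.+1 o, v o)).
Proof.
move=> my mu mv; have sH := history_sigma x0 w m.+1.
have sub := @le_history W (X 0%N) Omega x0 w m m.+1 (leqnSn m).
have cX := borel_space_countable_base (XSb mT).
have cU := borel_space_countable_base (Un_borel _ mT).
have cW := borel_space_countable_base (WSb mT).
have cV := borel_space_countable_base (UfSb mT).
apply: (measurable_wrt_pair sH _ cV _ mv).
  by apply: countable_base_prod => //; exact: countable_base_prod.
apply: (measurable_wrt_pair sH _ cW) => //; first exact: countable_base_prod.
  by apply: (measurable_wrt_pair sH cX cU) => B bB; apply: sub; [exact: my|exact: mu].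
by move=> B; exact: history_noise.
Qed.

Section policy.
Unset Implicit Arguments.
Variables (t : nat) (un : forall i : 'I_t, Omega -> Un i)
  (uf : forall i : 'I_t, Omega -> Uf i.+1) (x : forall i : 'I_t.+1, Omega -> X i).
Hypotheses (tT : (t <= T)%N) (adm : admissible f x0 w un uf x).
Set Implicit Arguments.

Let un_hist (i : 'I_t) : measurable_wrt (history x0 w i) (un i).
Proof. by have [h _ _ _] := adm; apply/sigma_ofP; have [] := h i. Qed.

Let uf_hist (i : 'I_t) : measurable_wrt (history x0 w i.+1) (uf i).
Proof. by have [_ h _ _] := adm; apply/sigma_ofP; have [] := h i. Qed.

Lemma state_measurable (i : 'I_t.+1) : measurable_wrt (history x0 w i) (x i).
Proof.
case: i => m; elim: m => [|m IH] p.
  have -> : x (Ordinal p) = x0.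
    by have [_ _ <- _] := adm; exact: (ord_irr x).
  apply/sigma_ofP => E xE; apply: sub_sigma_algebra; by left.
have mt : (m < t)%N by [].
have mT := leq_trans mt tT.
pose i := Ordinal mt.
have -> : x (Ordinal p) = x (lift ord0 i) by exact: (ord_irr x).
have [_ _ _ dyn] := adm.
rewrite (funext (dyn i)) => B bB.
have -> : x (widen_ord (leqnSn t) i) = x (Ordinal (ltnW p)) by exact: (ord_irr x).
have m4 := decision_measurable mT (IH (ltnW p)) (@un_hist i) (@uf_hist i).
apply: (m4 (f m @^-1` B)).
exact: f_meas.
Qed.

Definition running_cost (o : Omega) : \bar R := \sum_(i < t)
  L i (x (widen_ord (leqnSn t) i) o, un i o, w i.+1 o, uf i o).

Lemma running_cost_ge0 o : 0 <= running_cost o.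
Proof. by apply: sume_ge0 => i _; apply: L_ge0; exact: leq_trans tT. Qed.

Lemma running_cost_lsa : lsa (@borel Omega) running_cost.
Proof.
apply: lsa_sum => [|i o|i]; first exact: borel_sigma.
  by apply: L_ge0; exact: leq_trans tT.
have iT : (i < T)%N := leq_trans (ltn_ord i) tT.
apply: (lsa_comp (g := fun o => (x (widen_ord (leqnSn t) i) o, un i o, w i.+1 o, uf i o))
  _ (L_suslin iT)) => B bB.
apply: (history_borel x0_meas w_meas iT).
by apply: (decision_measurable iT) bB;
  [exact: (@state_measurable (widen_ord _ i))|exact: un_hist|exact: uf_hist].
Qed.

End policy.

(* The infimum at horizon [t] with terminal cost [V t] does not depend on [t]. *)
Let value t := problem_value (T := t) f L (V t) P x0 w.

Let value0 : value 0%N = V 0%N a.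
Proof.
have costE un uf x : admissible f x0 w un uf x ->
    cost (T := 0%N) L (V 0%N) P w un uf x = V 0%N a.
  move=> [_ _ ex _]; rewrite /cost.
  rewrite (_ : (fun=> _) = fun=> V 0%N a).
    by apply: expect_cst; exact: (V_lsa (leq0n T)).1.
  apply/funext => o; rewrite big_ord0 add0e; congr (V _).
  have -> : x ord_max = x ord0 by exact: (ord_irr x).
  by rewrite ex x0_deterministic.
rewrite /value /problem_value.
rewrite (_ : [set _ | _] = [set V 0%N a]) ?ereal_inf1//.
apply/seteqP; split=> c; first by move=> [un [uf [x [adm ->]]]]; rewrite costE.
move=> ->.
(* At horizon 0 a policy has no decision and a single state, obtained by extending an empty family
   by [x0]. *)
have [un _] : exists un : forall i : 'I_0, Omega -> Un i, True.
  by unshelve eexists; [case|].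
have [uf _] : exists uf : forall i : 'I_0, Omega -> Uf i.+1, True.
  by unshelve eexists; [case|].
have [g _] : exists g : forall i : 'I_0, Omega -> X i, True.
  by unshelve eexists; [case|].
have [x [_ xm]] := @ord_extend (fun i => Omega -> X i) 0%N g x0.
have adm : admissible f x0 w un uf x.
  split; [by case|by case| |by case].
  by rewrite -xm; exact: (ord_irr x).
by exists un, uf, x; rewrite costE.
Qed.

Let cost_step t (un : forall i : 'I_t, Omega -> Un i)
    (uf : forall i : 'I_t, Omega -> Uf i.+1) (x : forall i : 'I_t.+1, Omega -> X i)
    (un' : forall i : 'I_t.+1, Omega -> Un i)
    (uf' : forall i : 'I_t.+1, Omega -> Uf i.+1)
    (x' : forall i : 'I_t.+2, Omega -> X i) :
  (forall i, un' (widen_ord (leqnSn t) i) = un i) ->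
  (forall i, uf' (widen_ord (leqnSn t) i) = uf i) ->
  (forall i, x' (widen_ord (leqnSn t.+1) i) = x i) ->
  admissible f x0 w un' uf' x' ->
  cost (T := t.+1) L (V t.+1) P w un' uf' x' =
  expect P (fun o => running_cost un uf x o +
    J (x ord_max o, un' ord_max o, w t.+1 o, uf' ord_max o)).
Proof.
move=> eun euf ex [_ _ _ dyn]; congr (expect P _); apply/funext => o.
rewrite big_ord_recr /= -addeA; congr (_ + _).
  by apply: eq_bigr => i _; rewrite ex eun euf.
rewrite ex /J; congr (_ + V _ _).
have -> : x' ord_max = x' (lift ord0 ord_max) by exact: (ord_irr x').
by rewrite dyn ex.
Qed.

(** Cutting off the last step of a policy leaves an admissible one, whose cost [step_lower] compares
    through the removed decisions. *)
Let value_le t : (t < T)%N -> value t <= value t.+1.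
Proof.
move=> tT; apply: le_ereal_inf_tmp => _ [un' [uf' [x' [adm' ->]]]].
pose un (i : 'I_t) := un' (widen_ord (leqnSn t) i).
pose uf (i : 'I_t) := uf' (widen_ord (leqnSn t) i).
pose x (i : 'I_t.+1) := x' (widen_ord (leqnSn t.+1) i).
have [hun huf hx0 dyn] := adm'.
have adm : admissible f x0 w un uf x.
  split.
  - by move=> i; exact: (hun (widen_ord (leqnSn t) i)).
  - by move=> i; exact: (huf (widen_ord (leqnSn t) i)).
  - by rewrite -hx0; exact: (ord_irr x').
  - move=> i o; have := dyn (widen_ord (leqnSn t) i) o.
    have -> : x' (lift ord0 (widen_ord (leqnSn t) i)) = x (lift ord0 i).
      exact: (ord_irr x').
    by move=> ->.
rewrite (@cost_step t un uf x)//.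
have [V0 lV] := V_lsa tT; have [J0 lJ] := J_lsa tT V0 lV.
apply: (@le_trans _ _ (cost (T := t) L (V t) P w un uf x)).
  by apply: ereal_inf_lbound; exists un, uf, x.
rewrite /cost (V_step tT).
apply: (@step_lower R (X t) (Un t) (W t.+1) (Uf t.+1) Omega P (XSb tT)
  (Un_borel _ tT) (WSb tT) (UfSb tT) (w t.+1) (@J t) (wSm tT) J0 lJ
  (history x0 w t) (history x0 w t.+1)).
- exact: history_sigma.
- exact: history_sigma.
- exact: le_history.
- exact: (history_borel x0_meas w_meas tT).
- by move=> B; exact: history_noise.
- exact: (history_indep w_meas x0_deterministic w_indep tT).
- exact: (state_measurable (ltnW tT) adm (i := ord_max)).
- exact: running_cost_ge0 (ltnW tT).
- exact: running_cost_lsa (ltnW tT) adm.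
- by apply/sigma_ofP; have [] := hun ord_max.
- by apply/sigma_ofP; have [] := huf ord_max.
Qed.

(** With an empty decision space no policy can be extended; the upper bound then holds because every
    cost with terminal term [V t] is infinite. *)
Let V_infinite t : (t < T)%N -> ~ (inhabited (Un t) /\ inhabited (Uf t.+1)) ->
  V t = fun=> +oo.
Proof.
move=> tT ni; apply/funext => x; rewrite V_backward//.
have [[u]|nU] := pselect (inhabited (Un t)); last first.
  rewrite [X in ereal_inf X](_ : _ = set0) ?ereal_inf0//.
  by apply/seteqP; split=> // z [u]; exfalso; apply: nU; exists.
apply/eqP; rewrite -leye_eq; apply: le_ereal_inf_tmp => _ [u' _ <-].
rewrite -[leLHS](@expect_cst _ _ P +oo)//.
rewrite (_ : (fun=> +oo) = fun o => ereal_inf (range (fun uf : Uf t.+1 =>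
  L t (x, u', w t.+1 o, uf) + V t.+1 (f t (x, u', w t.+1 o, uf)))))//.
apply/funext => o; apply/esym; rewrite [X in ereal_inf X](_ : _ = set0) ?ereal_inf0//.
apply/seteqP; split=> // z [v]; exfalso; apply: ni; split; by exists.
Qed.

(** A policy is extended by e-optimal decisions for one more step. Since [e] is eliminated at each
    step, no error accumulates over the horizon. *)
Let value_ge t : (t < T)%N -> value t.+1 <= value t.
Proof.
move=> tT; apply: le_ereal_inf_tmp => _ [un [uf [x [adm ->]]]].
have tT' := ltnW tT.
have S0 := @running_cost_ge0 t un uf x tT'.
have lS := running_cost_lsa tT' adm.
have [[[u0] [v0]]|ni] := pselect (inhabited (Un t) /\ inhabited (Uf t.+1)); last first.
  rewrite /cost (V_infinite tT ni).
  rewrite [X in expect P X](_ : _ = fun=> +oo) ?expect_cst ?leey//.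
  apply/funext => o; rewrite addey//.
  by have := S0 o; rewrite /running_cost; case: (\sum_(i < t) _).
apply/lee_addgt0Pr => e e0.
have [V0 lV] := V_lsa tT; have [J0 lJ] := J_lsa tT V0 lV.
have mx := state_measurable tT' adm (i := ord_max).
have [||||||u [v [mu mv le]]] := @step_upper R (X t) (Un t) (W t.+1) (Uf t.+1) Omega P (XSb tT)
  (Un_borel _ tT) (WSb tT) (UfSb tT) (w t.+1) (@J t) (wSm tT) J0 lJ
  (history x0 w t) (history x0 w t.+1) _ _ _ _ _ _ (x ord_max)
  (running_cost un uf x) mx S0 lS u0 v0 e e0.
- exact: history_sigma.
- exact: history_sigma.
- exact: le_history.
- exact: (history_borel x0_meas w_meas tT).
- by move=> B; exact: history_noise.
- exact: (history_indep w_meas x0_deterministic w_indep tT).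
have [un' [eun un'm]] := @ord_extend (fun i => Omega -> Un i) t un u.
have [uf' [euf uf'm]] := @ord_extend (fun i => Omega -> Uf i.+1) t uf v.
have [x' [ex x'm]] := @ord_extend (fun i => Omega -> X i) t.+1 x
  (fun o => f t (x ord_max o, u o, w t.+1 o, v o)).
have [hun huf hx0 dyn] := adm.
have adm' : admissible f x0 w un' uf' x'.
  split.
  - apply: ord_widen_max => [i|]; rewrite ?eun ?un'm; first exact: hun.
    by split; [move=> B /mu; exact: (history_borel x0_meas w_meas tT')|exact/sigma_ofP].
  - apply: ord_widen_max => [i|]; rewrite ?euf ?uf'm; first exact: huf.
    by split; [move=> B /mv; exact: (history_borel x0_meas w_meas tT)|exact/sigma_ofP].
  - by rewrite -hx0 -ex; exact: (ord_irr x').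
  - apply: ord_widen_max => [i|] o.
      rewrite eun euf ex.
      have -> : x' (lift ord0 (widen_ord (leqnSn t) i)) = x (lift ord0 i).
        by rewrite -ex; exact: (ord_irr x').
      by rewrite dyn.
    rewrite un'm uf'm ex.
    have -> : x' (lift ord0 ord_max) = x' ord_max by exact: (ord_irr x').
    by rewrite x'm.
apply: (@le_trans _ _ (cost (T := t.+1) L (V t.+1) P w un' uf' x')).
  by apply: ereal_inf_lbound; exists un', uf', x'.
by rewrite (@cost_step t un uf x)// un'm uf'm /cost (V_step tT).
Qed.

Lemma problem_value_dp : problem_value f L (V T) P x0 w = V 0%N a.
Proof.
(* Only the horizon of [value] varies in the induction; the [T] that bounds it and occurs in the
   hypotheses stays fixed. *)
rewrite -/(value T) -value0; elim: {-2}T (leqnn T) => // t IH tT.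
apply/eqP; rewrite eq_le; apply/andP; split.
  by rewrite (le_trans (value_ge tT))// IH// ltnW.
by rewrite (le_trans _ (value_le tT))// IH// ltnW.
Qed.

End dynamic_programming.

Unset Implicit Arguments.
Set Strict Implicit.

Theorem proposition13 (R : realType) (T : nat) (T_ge1 : (1 <= T)%N)
  (Un Uf W X : nat -> topologicalType)
  (Un_borel : forall t, (t < T)%N -> borel_space R (Un t))
  (Uf_borel : forall t, (1 <= t <= T)%N -> borel_space R (Uf t))
  (W_borel : forall t, (1 <= t <= T)%N -> borel_space R (W t))
  (X_borel : forall t, (t <= T)%N -> borel_space R (X t))
  (f : forall t : nat, X t * Un t * W t.+1 * Uf t.+1 -> X t.+1)
  (f_meas : forall t, (t < T)%N -> borel_measurable (f t))
  (L : forall t : nat, X t * Un t * W t.+1 * Uf t.+1 -> \bar R)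
  (L_ge0 : forall t, (t < T)%N -> forall z, 0 <= L t z)
  (L_lsa : forall t, (t < T)%N -> lower_semianalytic (L t))
  (K : X T -> \bar R)
  (K_ge0 : forall z, 0 <= K z)
  (K_lsa : lower_semianalytic K)
  (Omega : ptopologicalType) (Omega_borel : borel_space R Omega)
  (P : probability (borelType Omega) R)
  (x0 : Omega -> X 0%N) (x0_meas : borel_measurable x0)
  (w : forall t : nat, Omega -> W t)
  (w_meas : forall t, (1 <= t <= T)%N -> borel_measurable (w t))
  (a : X 0%N) (x0_deterministic : forall o, x0 o = a)
  (w_indep : mutually_independent P (fun t : 'I_T => w t.+1))
  (V : forall t : nat, X t -> \bar R)
  (V_final : forall x : X T, V T x = K x)
  (V_backward : forall t, (t < T)%N -> forall x : X t,
    V t x = ereal_inf (range (fun un : Un t =>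
      expect P (fun o => ereal_inf (range (fun uf : Uf t.+1 =>
        L t (x, un, w t.+1 o, uf) + V t.+1 (f t (x, un, w t.+1 o, uf)))))))) :
  problem_value f L K P x0 w = V 0%N a.
Proof.
have VK : V T = K by exact/funext.
have VT0 z : 0 <= V T z by rewrite VK.
have VTl : lower_semianalytic (V T) by rewrite VK.
rewrite -VK.
exact: (problem_value_dp Un_borel Uf_borel W_borel X_borel f_meas L_ge0 L_lsa
  x0_meas w_meas x0_deterministic w_indep VT0 VTl V_backward).
Qed.
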